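(* Let $k$ be an algebraically closed field and let $\mathsf{T}$ be a $k$-linear triangulated category with suspension functor $\Sigma$ and Serre functor $S$, which has finite dimensional $\operatorname{Hom}$ spaces and split idempotents. Let $\tau=\Sigma^{-1}\circ S$ be the Auslander-Reiten translation of $\mathsf{T}$. Let $\mathbb{X}$ be a class of objects of $\mathsf{T}$, closed under isomorphisms, direct sums, and direct summands, which is both precovering and preenveloping. Then the pretriangulated structure of the quotient category $\mathsf{T}_{\mathbb{X}}$ (described in the context) is a triangulated structure if and only if $\tau\mathbb{X}=\mathbb{X}$.
   Context: Serre functor: an autoequivalence $S$ of $\mathsf{T}$ with natural isomorphisms $\mathsf{T}(A,B)\cong\operatorname{Hom}_k(\mathsf{T}(B,SA),k)$. The notation $\tau\mathbb{X}=\mathbb{X}$ means that the class of objects isomorphic to objects in $\tau\mathbb{X}$ equals $\mathbb{X}$. Quotient category: $\mathsf{T}_{\mathbb{X}}$ has the same objects as $\mathsf{T}$, and $\mathsf{T}_{\mathbb{X}}(A,B)=\mathsf{T}(A,B)/\mathbb{X}(A,B)$, where $\mathbb{X}(A,B)$ is the set of morphisms $A\to B$ which factor through an object of $\mathbb{X}$. The image of a morphism $\mu$ in $\mathsf{T}_{\mathbb{X}}$ is denoted $\underline{\mu}$. Preenveloping / precovering: $\mathbb{X}$ is preenveloping if each object $M$ has an $\mathbb{X}$-preenvelope, i.e. a morphism $M\to X_M$ with $X_M\in\mathbb{X}$ such that each morphism $M\to X$ with $X\in\mathbb{X}$ factors through $M\to X_M$. Dually, $\mathbb{X}$ is precovering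 if each object $M$ has an $\mathbb{X}$-precover, i.e. a morphism $X^M\to M$ with $X^M\in\mathbb{X}$ such that each morphism $X\to M$ with $X\in\mathbb{X}$ factors through $X^M\to M$. A morphism $M\to N$ is an $\mathbb{X}$-monomorphism if each morphism $M\to X$ with $X\in\mathbb{X}$ factors through $M\to N$; it is an $\mathbb{X}$-epimorphism if each morphism $X\to N$ with $X\in\mathbb{X}$ factors through $M\to N$. Pretriangulated category: an additive category with an endofunctor $\sigma$ and a class of distinguished right-triangles $A\to B\to C\to\sigma A$, and an endofunctor $\omega$ and a class of distinguished left-triangles $\omega Z\to X\to Y\to Z$; the right-triangles satisfy the axioms of a triangulated category except that $\sigma$ is not required to be an equivalence, similarly for the left-triangles with $\omega$, and there are compatibility conditions, most importantly that $(\sigma,\omega)$ is an adjoint pair (see Beligiannis-Reiten). The pretriangulated structure of $\mathsf{T}_{\mathbb{X}}$: for each $M$ choose an $\mathbb{X}$-preenvelope and an $\mathbb{X}$-precover and complete them to distinguished triangles $M\to X_M\to\sigma M\to\Sigma M$ and $\Sigma^{-1}M\to\omega M\to X^M\to M$ in $\mathsf{T}$; this defines $\sigma M$ and $\omega M$. For a morphism $\mu:M\to N$ in $\mathsf{T}$, choose $\xi:X_M\to X_N$ and $s:\sigma M\to\sigma N$ such that $(\mu,\xi,s,\Sigma\mu)$ is a morphism of distinguished triangles, and set $\sigma(\underline{\mu})=\underline{s}$; $\omega$ is defined on morphisms dually. If $\mu:M\to N$ is an $\mathbb{X}$-monomorphism in $\mathsf{T}$, extend it to a distinguished triangle $M\xrightarrow{\mu}N\xrightarrow{\nu}P\to\Sigma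 M$ and choose a morphism of distinguished triangles $(\mathrm{id}_M,n,\pi,\mathrm{id}_{\Sigma M})$ from it to $M\to X_M\to\sigma M\to\Sigma M$; the diagram $M\xrightarrow{\underline{\mu}}N\xrightarrow{\underline{\nu}}P\xrightarrow{\underline{\pi}}\sigma M$ is declared a distinguished right-triangle in $\mathsf{T}_{\mathbb{X}}$ (distinguished triangles being taken up to isomorphism). Distinguished left-triangles are obtained dually from $\mathbb{X}$-epimorphisms. The choices made do not matter up to equivalence, and this makes $\mathsf{T}_{\mathbb{X}}$ pretriangulated. This structure is a triangulated structure when $\mathsf{T}_{\mathbb{X}}$, with suspension functor $\sigma$ and the distinguished right-triangles as distinguished triangles, is a triangulated category; equivalently, when $\sigma$ is an autoequivalence. *)

(* Defs.v *)
From HB Require Import structures.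
From mathcomp Require Import all_boot all_order all_algebra.
From mathcomp Require Import boolp.
Set Implicit Arguments.
Unset Strict Implicit.
Unset Printing Implicit Defensive.

Import GRing.Theory.
Local Open Scope ring_scope.

Declare Scope cat_scope.
Delimit Scope cat_scope with cat.
Reserved Notation "g ∘ f" (at level 40, left associativity).

Definition is_zero_object (Ob : Type) (hom : Ob -> Ob -> zmodType) (Z : Ob) :=
  (forall A (f : hom A Z), f = 0) /\ (forall A (f : hom Z A), f = 0).

Definition is_biproduct (Ob : Type) (hom : Ob -> Ob -> zmodType)
    (idm : forall A, hom A A)
    (comp : forall A B C, hom B C -> hom A B -> hom A C) (A B P : Ob)
    (i1 : hom A P) (i2 : hom B P) (p1 : hom P A) (p2 : hom P B) :=
  [/\ comp _ _ _ p1 i1 = idm A, comp _ _ _ p2 i2 = idm B,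
      comp _ _ _ p2 i1 = 0, comp _ _ _ p1 i2 = 0
    & comp _ _ _ i1 p1 + comp _ _ _ i2 p2 = idm P].

Record addCat := AddCat {
  obj :> Type;
  hom : obj -> obj -> zmodType;
  idm : forall A, hom A A;
  comp : forall A B C, hom B C -> hom A B -> hom A C;
  compA : forall A B C D (h : hom C D) (g : hom B C) (f : hom A B),
    comp h (comp g f) = comp (comp h g) f;
  comp1m : forall A B (f : hom A B), comp (idm B) f = f;
  compm1 : forall A B (f : hom A B), comp f (idm A) = f;
  compDl : forall A B C (g g' : hom B C) (f : hom A B),
    comp (g + g') f = comp g f + comp g' f;
  compDr : forall A B C (g : hom B C) (f f' : hom A B),
    comp g (f + f') = comp g f + comp g f';
  has_zero : exists Z, is_zero_object hom Z;
  has_biproducts : forall A B, exists P i1 i2 p1 p2,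
    @is_biproduct obj hom idm comp A B P i1 i2 p1 p2
}.

Arguments hom {_}.
Arguments idm {_}.
Arguments comp {_ A B C}.
Notation "g ∘ f" := (comp g f) : cat_scope.
Local Open Scope cat_scope.

Definition zero_object (C : addCat) (Z : C) := is_zero_object (@hom C) Z.

Definition biproduct (C : addCat) (A B P : C)
    (i1 : hom A P) (i2 : hom B P) (p1 : hom P A) (p2 : hom P B) :=
  is_biproduct (@idm C) (@comp C) i1 i2 p1 p2.

Definition is_iso (C : addCat) (A B : C) (f : hom A B) :=
  exists g : hom B A, g ∘ f = idm A /\ f ∘ g = idm B.

Definition isomorphic (C : addCat) (A B : C) :=
  exists f : hom A B, is_iso f.

Definition split_idempotents (C : addCat) :=
  forall (A : C) (e : hom A A), e ∘ e = e ->
  exists (B : C) (r : hom A B) (s : hom B A), r ∘ s = idm B /\ s ∘ r = e.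

(* Finite dimensionality is part of [vectType k]. *)
Record linCat (k : fieldType) := LinCat {
  lobj : Type;
  lhom : lobj -> lobj -> vectType k;
  lidm : forall A, lhom A A;
  lcomp : forall A B C, lhom B C -> lhom A B -> lhom A C;
  lcompA : forall A B C D (h : lhom C D) (g : lhom B C) (f : lhom A B),
    lcomp h (lcomp g f) = lcomp (lcomp h g) f;
  lcomp1m : forall A B (f : lhom A B), lcomp (lidm B) f = f;
  lcompm1 : forall A B (f : lhom A B), lcomp f (lidm A) = f;
  lcompDl : forall A B C (g g' : lhom B C) (f : lhom A B),
    lcomp (g + g') f = lcomp g f + lcomp g' f;
  lcompDr : forall A B C (g : lhom B C) (f f' : lhom A B),
    lcomp g (f + f') = lcomp g f + lcomp g f';
  lcompZl : forall A B C (a : k) (g : lhom B C) (f : lhom A B),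
    lcomp (a *: g) f = a *: lcomp g f;
  lcompZr : forall A B C (a : k) (g : lhom B C) (f : lhom A B),
    lcomp g (a *: f) = a *: lcomp g f;
  lhas_zero : exists Z, is_zero_object (fun A B => lhom A B : zmodType) Z;
  lhas_biproducts : forall A B, exists P i1 i2 p1 p2,
    @is_biproduct lobj (fun A B => lhom A B : zmodType) lidm lcomp
      A B P i1 i2 p1 p2
}.

Arguments lhom {k _}.

Definition addCat_of_linCat (k : fieldType) (T : linCat k) : addCat :=
  AddCat (@lcompA k T) (@lcomp1m k T) (@lcompm1 k T)
    (@lcompDl k T) (@lcompDr k T) (@lhas_zero k T) (@lhas_biproducts k T).

Coercion addCat_of_linCat : linCat >-> addCat.

(* Equivalences between additive categories are automatically additive, so
   building additivity in loses nothing for suspensions and Serre functors. *)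
Record functor (C D : addCat) := Functor {
  fobj :> C -> D;
  fmap : forall A B : C, hom A B -> hom (fobj A) (fobj B);
  fmap1 : forall A : C, fmap (idm A) = idm (fobj A);
  fmapM : forall (A B E : C) (g : hom B E) (f : hom A B),
    fmap (g ∘ f) = fmap g ∘ fmap f;
  fmapD : forall (A B : C) (f g : hom A B), fmap (f + g) = fmap f + fmap g
}.

Arguments fmap {C D} _ {A B}.

Definition functor_comp (C D E : addCat) (G : functor D E) (F : functor C D) :
    functor C E.
Proof.
exists (fun A => G (F A)) (fun A B f => fmap G (fmap F f)).
- by move=> A; rewrite !fmap1.
- by move=> A B K g f; rewrite !fmapM.
- by move=> A B f g; rewrite !fmapD.
Defined.

Record quasi_inverse (C : addCat) (F : functor C C) := QuasiInverse {
  qinv :> functor C C;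
  qcounit : forall A : C, hom (F (qinv A)) A;
  qcounit_iso : forall A, is_iso (qcounit A);
  qcounit_nat : forall (A B : C) (f : hom A B),
    f ∘ qcounit A = qcounit B ∘ fmap F (fmap qinv f);
  qunit : forall A : C, hom A (qinv (F A));
  qunit_iso : forall A, is_iso (qunit A);
  qunit_nat : forall (A B : C) (f : hom A B),
    fmap qinv (fmap F f) ∘ qunit A = qunit B ∘ f
}.

Definition autoequivalence (C : addCat) (F : functor C C) :=
  inhabited (quasi_inverse F).

Definition linear_functor (k : fieldType) (T : linCat k) (F : functor T T) :=
  forall (A B : T) (a : k) (f : lhom A B),
    fmap F (a *: f) = a *: (fmap F f : lhom (F A) (F B)).

Record serre_functor (k : fieldType) (T : linCat k) := SerreFunctor {
  serre :> functor T T;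
  serre_linear : linear_functor serre;
  serre_equiv : autoequivalence serre;
  serre_dual : forall A B : T,
    {linear lhom A B -> 'Hom(lhom B (serre A) : vectType k, k^o)};
  serre_dual_bij : forall A B : T, bijective (serre_dual A B);
  serre_dual_natl : forall (A A' B : T) (f : hom A B) (a : hom A' A)
      (g : hom B (serre A')),
    serre_dual A' B (f ∘ a) g = serre_dual A B f (fmap serre a ∘ g);
  serre_dual_natr : forall (A B B' : T) (f : hom A B) (b : hom B B')
      (g : hom B' (serre A)),
    serre_dual A B' (b ∘ f) g = serre_dual A B f (g ∘ b)
}.

Section Triangulated.
Variables (C : addCat) (Sg : functor C C).

Definition tri_class :=
  forall A B D : C, hom A B -> hom B D -> hom D (Sg A) -> Prop.

Definition tri_morph (A B D A' B' D' : C)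
    (f : hom A B) (g : hom B D) (h : hom D (Sg A))
    (f' : hom A' B') (g' : hom B' D') (h' : hom D' (Sg A'))
    (a : hom A A') (b : hom B B') (d : hom D D') :=
  [/\ b ∘ f = f' ∘ a, d ∘ g = g' ∘ b & fmap Sg a ∘ h = h' ∘ d].

Record triangulated (dist : tri_class) : Prop := Triangulated {
  susp_equiv : autoequivalence Sg;
  tri_iso : forall (A B D A' B' D' : C)
      (f : hom A B) (g : hom B D) (h : hom D (Sg A))
      (f' : hom A' B') (g' : hom B' D') (h' : hom D' (Sg A'))
      (a : hom A A') (b : hom B B') (d : hom D D'),
    tri_morph f g h f' g' h' a b d -> is_iso a -> is_iso b -> is_iso d ->
    dist _ _ _ f g h -> dist _ _ _ f' g' h';
  tri_id : forall A Z : C, zero_object Z ->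
    dist _ _ _ (idm A) (0 : hom A Z) 0;
  tri_ex : forall (A B : C) (f : hom A B), exists D g h, dist A B D f g h;
  tri_rot : forall (A B D : C) (f : hom A B) (g : hom B D) (h : hom D (Sg A)),
    dist _ _ _ f g h <-> dist _ _ _ g h (- fmap Sg f);
  tri_fill : forall (A B D A' B' D' : C)
      (f : hom A B) (g : hom B D) (h : hom D (Sg A))
      (f' : hom A' B') (g' : hom B' D') (h' : hom D' (Sg A'))
      (a : hom A A') (b : hom B B'),
    dist _ _ _ f g h -> dist _ _ _ f' g' h' -> b ∘ f = f' ∘ a ->
    exists d, tri_morph f g h f' g' h' a b d;
  tri_oct : forall (A B D P Q R : C) (f : hom A B) (g : hom B D)
      (f1 : hom B P) (f2 : hom P (Sg A))
      (g1 : hom D R) (g2 : hom R (Sg B))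
      (h1 : hom D Q) (h2 : hom Q (Sg A)),
    dist _ _ _ f f1 f2 -> dist _ _ _ g g1 g2 -> dist _ _ _ (g ∘ f) h1 h2 ->
    exists (u : hom P Q) (v : hom Q R),
      [/\ dist _ _ _ u v (fmap Sg f1 ∘ g2),
          u ∘ f1 = h1 ∘ g, h2 ∘ u = f2, v ∘ h1 = g1
        & g2 ∘ v = fmap Sg f ∘ h2]
}.

End Triangulated.

(* Only the data: the axioms of right- and left-triangles and the adjunction
   between the two endofunctors are not part of the record. *)
Record pretriangulation (C : addCat) := Pretriangulation {
  pt_susp : functor C C;
  pt_right : forall A B D : C,
    hom A B -> hom B D -> hom D (pt_susp A) -> Prop;
  pt_loop : functor C C;
  pt_left : forall A B D : C,
    hom (pt_loop D) A -> hom A B -> hom B D -> Prop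
}.

(* Only the right half of the data is tested. *)
Definition is_triangulated_structure (C : addCat) (P : pretriangulation C) :=
  triangulated (@pt_right C P).

Section Approximations.
Variables (T : addCat) (X : T -> Prop).

Definition factors (A B : T) (f : hom A B) :=
  exists (E : T) (g : hom A E) (h : hom E B), X E /\ f = h ∘ g.

Definition xmono (M N : T) (f : hom M N) :=
  forall (E : T) (g : hom M E), X E -> exists h, g = h ∘ f.

Definition xepi (M N : T) (f : hom M N) :=
  forall (E : T) (g : hom E N), X E -> exists h, g = f ∘ h.

Definition preenvelope (M E : T) (i : hom M E) := X E /\ xmono i.
Definition precover (M E : T) (p : hom E M) := X E /\ xepi p.

(* A full subcategory closed under isomorphisms, finite direct sums and direct
   summands in which every object of T has both kinds of approximation. *)
Record functorially_finite : Prop := FunctoriallyFinite {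
  X_iso : forall A B, isomorphic A B -> X A -> X B;
  X_sum : forall A B P i1 i2 p1 p2,
    @biproduct T A B P i1 i2 p1 p2 -> X A -> X B -> X P;
  (* Biproducts are symmetric, so this covers both summands. *)
  X_summand : forall A B P i1 i2 p1 p2,
    @biproduct T A B P i1 i2 p1 p2 -> X P -> X A;
  X_precovering : forall M, exists E p, @precover M E p;
  X_preenveloping : forall M, exists E i, @preenvelope M E i
}.

End Approximations.

Section Translation.
Variables (k : fieldType) (T : linCat k) (Sg : functor T T).

Definition AR_translation (Sgi : quasi_inverse Sg) (S : serre_functor T) :
  functor T T := functor_comp Sgi S.

(* F X = X : the objects isomorphic to some F N with N in X are those of X. *)
Definition image_eq (F : functor T T) (X : T -> Prop) :=
  forall M : T, (exists2 N, X N & isomorphic M (F N)) <-> X M.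

End Translation.

Section PreadditiveFacts.
Variable C : addCat.

Lemma comp0m (A B D : C) (f : hom A B) : @comp C A B D 0 f = 0.
Proof. by apply: (addIr (0 ∘ f)); rewrite -compDl !add0r. Qed.

Lemma compm0 (A B D : C) (g : hom B D) : @comp C A B D g 0 = 0.
Proof. by apply: (addIr (g ∘ 0)); rewrite -compDr !add0r. Qed.

Lemma compNl (A B D : C) (g : hom B D) (f : hom A B) : (- g) ∘ f = - (g ∘ f).
Proof. by apply/eqP; rewrite -addr_eq0 -compDl addNr comp0m. Qed.

Lemma compNr (A B D : C) (g : hom B D) (f : hom A B) : g ∘ (- f) = - (g ∘ f).
Proof. by apply/eqP; rewrite -addr_eq0 -compDr addNr compm0. Qed.

Lemma compBl (A B D : C) (g g' : hom B D) (f : hom A B) :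
  (g - g') ∘ f = g ∘ f - g' ∘ f.
Proof. by rewrite compDl compNl. Qed.

Lemma compBr (A B D : C) (g : hom B D) (f f' : hom A B) :
  g ∘ (f - f') = g ∘ f - g ∘ f'.
Proof. by rewrite compDr compNr. Qed.

Variable F : functor C C.

Lemma fmap0 (A B : C) : fmap F (0 : hom A B) = 0.
Proof. by apply: (addIr (fmap F 0)); rewrite -fmapD !add0r. Qed.

Lemma fmapN (A B : C) (f : hom A B) : fmap F (- f) = - fmap F f.
Proof. by apply/eqP; rewrite -addr_eq0 -fmapD addNr fmap0. Qed.

Lemma fmapB (A B : C) (f g : hom A B) : fmap F (f - g) = fmap F f - fmap F g.
Proof. by rewrite fmapD fmapN. Qed.

End PreadditiveFacts.

Section Quotient.
Variables (T : addCat) (X : T -> Prop) (hX : functorially_finite X).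

Lemma factors0 (A B : T) : factors X (0 : hom A B).
Proof.
have [E [i [XE _]]] := X_preenveloping hX A.
by exists E, i, 0; rewrite comp0m.
Qed.

Lemma factorsN (A B : T) (f : hom A B) : factors X f -> factors X (- f).
Proof.
by move=> [E [g [h [XE ->]]]]; exists E, g, (- h); rewrite compNl.
Qed.

Lemma factorsD (A B : T) (f f' : hom A B) :
  factors X f -> factors X f' -> factors X (f + f').
Proof.
move=> [E [g [h [XE ->]]]] [E' [g' [h' [XE' ->]]]].
have [P [i1 [i2 [p1 [p2 b]]]]] := has_biproducts E E'.
exists P, (i1 ∘ g + i2 ∘ g'), (h ∘ p1 + h' ∘ p2); split.
  exact: (X_sum hX b).
case: b => e11 e22 e21 e12 _.
rewrite compDl !compDr.
have -> : h ∘ p1 ∘ (i1 ∘ g) = h ∘ (p1 ∘ i1) ∘ g by rewrite !compA.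
have -> : h ∘ p1 ∘ (i2 ∘ g') = h ∘ (p1 ∘ i2) ∘ g' by rewrite !compA.
have -> : h' ∘ p2 ∘ (i1 ∘ g) = h' ∘ (p2 ∘ i1) ∘ g by rewrite !compA.
have -> : h' ∘ p2 ∘ (i2 ∘ g') = h' ∘ (p2 ∘ i2) ∘ g' by rewrite !compA.
rewrite e11 e22 e21 e12.
by rewrite !compm0 !comp0m !compm1 addr0 add0r.
Qed.

Lemma factorsB (A B : T) (f f' : hom A B) :
  factors X f -> factors X f' -> factors X (f - f').
Proof. by move=> ff ff'; apply: factorsD => //; apply: factorsN. Qed.

Lemma factors_compl (A B D : T) (g : hom B D) (f : hom A B) :
  factors X f -> factors X (g ∘ f).
Proof.
by move=> [E [u [v [XE ->]]]]; exists E, u, (g ∘ v); rewrite compA.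
Qed.

Lemma factors_compr (A B D : T) (g : hom B D) (f : hom A B) :
  factors X g -> factors X (g ∘ f).
Proof.
by move=> [E [u [v [XE ->]]]]; exists E, (u ∘ f), v; rewrite compA.
Qed.

Definition qideal (A B : T) : {pred hom A B} :=
  fun f : hom A B => `[< factors X f >].

Fact qideal_zmod_closed (A B : T) : zmod_closed (@qideal A B).
Proof.
split; first by apply/asboolP; exact: factors0.
move=> f g /asboolP ff /asboolP fg; apply/asboolP; exact: factorsB.
Qed.

HB.instance Definition _ (A B : T) :=
  GRing.isZmodClosed.Build (hom A B) (@qideal A B) (qideal_zmod_closed A B).

Definition qhom (A B : T) : zmodType := {ideal_quot (@qideal A B)}.


Definition qpi (A B : T) (f : hom A B) : qhom A B :=
  \pi_({ideal_quot (@qideal A B)})%qT f.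

Definition qrepr (A B : T) (q : qhom A B) : hom A B :=
  repr (q : {ideal_quot (@qideal A B)}).

Lemma qreprK (A B : T) (q : qhom A B) : qpi (qrepr q) = q.
Proof. exact: reprK. Qed.

Lemma qpiP (A B : T) (f g : hom A B) : qpi f = qpi g <-> factors X (f - g).
Proof.
have e := Quotient.idealrBE (@qideal A B) f g.
split=> [fg|fg].
  by apply/asboolP; rewrite -[`[< _ >]]/(f - g \in @qideal A B) e; apply/eqP.
by apply/eqP; rewrite -e; apply/asboolP.
Qed.

Lemma qpiD (A B : T) (f g : hom A B) : qpi (f + g) = qpi f + qpi g.
Proof. by rewrite /qpi !piE. Qed.

Lemma qpi0 (A B : T) : qpi (0 : hom A B) = 0.
Proof. by rewrite /qpi !piE. Qed.

Definition qcomp (A B D : T) (g : qhom B D) (f : qhom A B) : qhom A D :=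
  qpi (qrepr g ∘ qrepr f).

Lemma qcompE (A B D : T) (g : hom B D) (f : hom A B) :
  qcomp (qpi g) (qpi f) = qpi (g ∘ f).
Proof.
apply/qpiP; set g' := qrepr _; set f' := qrepr _.
have gg' : factors X (g' - g) by apply/qpiP; rewrite qreprK.
have ff' : factors X (f' - f) by apply/qpiP; rewrite qreprK.
have -> : g' ∘ f' - g ∘ f = (g' - g) ∘ f' + g ∘ (f' - f).
  by rewrite compBl compBr addrA subrK.
by apply: factorsD; [apply: factors_compr | apply: factors_compl].
Qed.

Definition qid (A : T) : qhom A A := qpi (idm A).

Fact qcompA (A B C D : T) (h : qhom C D) (g : qhom B C) (f : qhom A B) :
  qcomp h (qcomp g f) = qcomp (qcomp h g) f.
Proof. by rewrite -[h]qreprK -[g]qreprK -[f]qreprK !qcompE compA. Qed.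

Fact qcomp1m (A B : T) (f : qhom A B) : qcomp (qid B) f = f.
Proof. by rewrite -[f]qreprK qcompE comp1m. Qed.

Fact qcompm1 (A B : T) (f : qhom A B) : qcomp f (qid A) = f.
Proof. by rewrite -[f]qreprK qcompE compm1. Qed.

Fact qcompDl (A B C : T) (g g' : qhom B C) (f : qhom A B) :
  qcomp (g + g') f = qcomp g f + qcomp g' f.
Proof.
by rewrite -[g]qreprK -[g']qreprK -[f]qreprK -qpiD !qcompE compDl qpiD.
Qed.

Fact qcompDr (A B C : T) (g : qhom B C) (f f' : qhom A B) :
  qcomp g (f + f') = qcomp g f + qcomp g f'.
Proof.
by rewrite -[g]qreprK -[f]qreprK -[f']qreprK -qpiD !qcompE compDr qpiD.
Qed.

Fact qhas_zero : exists Z, is_zero_object qhom Z.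
Proof.
have [Z [Z1 Z2]] := has_zero T; exists Z; split=> A f.
  by rewrite -[f]qreprK (Z1 _ (qrepr f)) qpi0.
by rewrite -[f]qreprK (Z2 _ (qrepr f)) qpi0.
Qed.

Fact qhas_biproducts (A B : T) : exists P i1 i2 p1 p2,
  @is_biproduct T qhom qid qcomp A B P i1 i2 p1 p2.
Proof.
have [P [i1 [i2 [p1 [p2 [e1 e2 e3 e4 e5]]]]]] := has_biproducts A B.
exists P, (qpi i1), (qpi i2), (qpi p1), (qpi p2).
by split; rewrite !qcompE ?e1 ?e2 ?e3 ?e4 ?qpi0 // -qpiD e5.
Qed.

Definition quotCat : addCat :=
  AddCat qcompA qcomp1m qcompm1 qcompDl qcompDr qhas_zero qhas_biproducts.

End Quotient.

(* Additive endofunctors of T/X obtained by lifting morphisms along a relation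
   on T which is total, functorial and additive, and respects X. *)
Section QuotientFunctor.
Variables (T : addCat) (X : T -> Prop) (hX : functorially_finite X).
Variables (F : T -> T) (R : forall A B : T, hom A B -> hom (F A) (F B) -> Prop).
Hypothesis R_total : forall A B (f : hom A B), exists s, R f s.
Hypothesis R_id : forall A, R (idm A) (idm (F A)).
Hypothesis R_comp : forall A B D (g : hom B D) (f : hom A B) t s,
  R g t -> R f s -> R (g ∘ f) (t ∘ s).
Hypothesis R_add : forall A B (f g : hom A B) s t,
  R f s -> R g t -> R (f + g) (s + t).
Hypothesis R_opp : forall A B (f : hom A B) s, R f s -> R (- f) (- s).
Hypothesis R_factors : forall A B (f : hom A B) s,
  R f s -> factors X f -> factors X s.

Definition lift_fmap (A B : quotCat hX) (q : hom A B) :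
    @hom (quotCat hX) (F A) (F B) :=
  qpi hX (projT1 (cid (R_total (qrepr q)))).

Lemma lift_fmapE (A B : T) (f : hom A B) s : R f s ->
  @lift_fmap A B (qpi hX f) = qpi hX s.
Proof.
rewrite /lift_fmap; case: cid => t /= Rt Rs; apply/qpiP.
apply: (R_factors (R_add Rt (R_opp Rs))).
by apply/(qpiP hX); rewrite qreprK.
Qed.

Fact lift_fmap1 (A : quotCat hX) :
  lift_fmap (idm A) = @idm (quotCat hX) (F A).
Proof. exact: lift_fmapE (R_id A). Qed.

Fact lift_fmapM (A B D : quotCat hX) (g : hom B D) (f : hom A B) :
  lift_fmap (g ∘ f) = lift_fmap g ∘ lift_fmap f.
Proof.
rewrite -(qreprK g) -(qreprK f).
have [t Rt] := R_total (qrepr g); have [s Rs] := R_total (qrepr f).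
rewrite (lift_fmapE Rt) (lift_fmapE Rs) /= !qcompE.
exact: lift_fmapE (R_comp Rt Rs).
Qed.

Fact lift_fmapD (A B : quotCat hX) (f g : hom A B) :
  lift_fmap (f + g) = lift_fmap f + lift_fmap g.
Proof.
rewrite -(qreprK g) -(qreprK f).
have [t Rt] := R_total (qrepr g); have [s Rs] := R_total (qrepr f).
rewrite (lift_fmapE Rt) (lift_fmapE Rs) -!qpiD.
exact: lift_fmapE (R_add Rs Rt).
Qed.

Definition lift_functor : functor (quotCat hX) (quotCat hX) :=
  @Functor (quotCat hX) (quotCat hX) F
    lift_fmap lift_fmap1 lift_fmapM lift_fmapD.

End QuotientFunctor.

Section Equivalence.
Variables (C : addCat) (F : functor C C) (G : quasi_inverse F).

Lemma iso_monic (A B D : C) (e : hom B D) (f g : hom A B) :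
  is_iso e -> e ∘ f = e ∘ g -> f = g.
Proof.
by move=> [d [de _]] /(congr1 (comp d)); rewrite !compA de !comp1m.
Qed.

Lemma iso_epic (A B D : C) (e : hom A B) (f g : hom B D) :
  is_iso e -> f ∘ e = g ∘ e -> f = g.
Proof.
move=> [d [_ ed]] /(congr1 (fun h => h ∘ d)).
by rewrite -!compA ed !compm1.
Qed.

Lemma fmap_faithful (A B : C) (f g : hom A B) : fmap F f = fmap F g -> f = g.
Proof.
move=> e; apply: (iso_monic (qunit_iso G B)).
by rewrite -!qunit_nat e.
Qed.

Lemma qinv_faithful (A B : C) (f g : hom A B) : fmap G f = fmap G g -> f = g.
Proof.
move=> e; apply: (iso_epic (qcounit_iso G A)).
by rewrite !qcounit_nat e.
Qed.

Lemma fmap_full (A B : C) (h : hom (F A) (F B)) : exists f, fmap F f = h.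
Proof.
have [v [vu uv]] := qunit_iso G B.
exists (v ∘ fmap G h ∘ qunit G A); apply: qinv_faithful.
apply: (iso_epic (qunit_iso G A)).
by rewrite qunit_nat !compA uv comp1m.
Qed.

End Equivalence.

Section TriangleFacts.
Variables (C : addCat) (Sg : functor C C) (dist : tri_class Sg).
Hypothesis hC : triangulated dist.

Lemma tri_weak_kernel (A B D W : C) (f : hom A B) (g : hom B D) h
    (t : hom W B) : dist f g h -> g ∘ t = 0 -> exists u, t = f ∘ u.
Proof.
move=> dfgh gt; have [G] := susp_equiv hC.
have [Z Z0] := has_zero C.
have d1 := (tri_rot hC _ _ _).1 (tri_id hC W Z0).
have d2 := (tri_rot hC _ _ _).1 dfgh.
have [|e [_ _ E]] := tri_fill hC d1 d2 (a := t) (b := 0).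
  by rewrite gt comp0m.
have [u Eu] := fmap_full G e; exists u.
apply: (fmap_faithful G); rewrite fmapM Eu.
by apply: oppr_inj; rewrite -compNl -E fmap1 compNr compm1.
Qed.

Lemma tri_weak_cokernel (A B D W : C) (f : hom A B) (g : hom B D) h
    (t : hom B W) : dist f g h -> t ∘ f = 0 -> exists u, t = u ∘ g.
Proof.
move=> dfgh tf; have [G] := susp_equiv hC.
have [Z [Z1 Z2]] := has_zero C.
have ZS : zero_object (Sg Z).
  have e : idm (Sg Z) = 0 by rewrite -fmap1 (Z1 _ (idm Z)) fmap0.
  split=> E k; first by rewrite -[k]comp1m e comp0m.
  by rewrite -[k]compm1 e compm0.
have d1 : dist (0 : hom Z W) (idm W) 0.
  apply/(tri_rot hC); rewrite fmap0 oppr0.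
  exact: (tri_id hC).
have [|u [_ E _]] := tri_fill hC dfgh d1 (a := 0) (b := t).
  by rewrite tf compm0.
by exists u; rewrite E comp1m.
Qed.

Lemma tri_comp0 (A B D : C) (f : hom A B) (g : hom B D) h :
  dist f g h -> g ∘ f = 0.
Proof.
move=> dfgh; have [Z Z0] := has_zero C.
have [|e [_ E _]] := tri_fill hC (tri_id hC A Z0) dfgh (a := idm A) (b := f).
  by rewrite !compm1.
by rewrite -E compm0.
Qed.

Lemma tri_fill_mid (A B D A' B' D' : C)
    (f : hom A B) (g : hom B D) (h : hom D (Sg A))
    (f' : hom A' B') (g' : hom B' D') (h' : hom D' (Sg A'))
    (a : hom A A') (d : hom D D') :
  dist f g h -> dist f' g' h' -> fmap Sg a ∘ h = h' ∘ d ->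
  exists b, tri_morph f g h f' g' h' a b d.
Proof.
move=> d1 d2 e; have [G] := susp_equiv hC.
have r1 := (tri_rot hC _ _ _).1 ((tri_rot hC _ _ _).1 d1).
have r2 := (tri_rot hC _ _ _).1 ((tri_rot hC _ _ _).1 d2).
have [b' [_ E1 E2]] := tri_fill hC r1 r2 e.
have [b Eb] := fmap_full G b'; exists b; split=> //.
  apply: (fmap_faithful G); rewrite !fmapM Eb.
  by apply: oppr_inj; rewrite -compNr E1 compNl.
apply: (fmap_faithful G); rewrite !fmapM Eb.
by apply: oppr_inj; rewrite -compNr E2 compNl.
Qed.

End TriangleFacts.

Section Pretriangulation.
Variables (T : addCat) (Sg : functor T T) (dist : tri_class Sg).
Hypothesis hT : triangulated dist.
Variable Sgi : quasi_inverse Sg.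
Variables (X : T -> Prop) (hX : functorially_finite X).

(* The triangle  Sg^-1 D --f--> A --g--> B --h--> D  is distinguished. *)
Definition left_dist (A B D : T)
    (f : hom (Sgi D) A) (g : hom A B) (h : hom B D) :=
  exists h' : hom B (Sg (Sgi D)), dist f g h' /\ qcounit Sgi D ∘ h' = h.

(* A chosen X-preenvelope with its cone  M -> X_M -> sigma M -> Sg M. *)
Record right_choice (M : T) := RightChoice {
  rc_env : T;
  rc_sigma : T;
  rc_i : hom M rc_env;
  rc_p : hom rc_env rc_sigma;
  rc_d : hom rc_sigma (Sg M);
  rc_pre : preenvelope X rc_i;
  rc_dist : dist rc_i rc_p rc_d
}.

(* A chosen X-precover completed to  Sg^-1 M -> omega M -> X^M -> M. *)
Record left_choice (M : T) := LeftChoice {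
  lc_cov : T;
  lc_omega : T;
  lc_d : hom (Sgi M) lc_omega;
  lc_i : hom lc_omega lc_cov;
  lc_p : hom lc_cov M;
  lc_pre : precover X lc_p;
  lc_dist : left_dist lc_d lc_i lc_p
}.

Lemma right_choice_ex (M : T) : inhabited (right_choice M).
Proof.
have [E [i pi]] := X_preenveloping hX M.
by have [D [g [h d]]] := tri_ex hT i; exists; exact: RightChoice pi d.
Qed.

Lemma left_choice_ex (M : T) : inhabited (left_choice M).
Proof.
have [E [p pp]] := X_precovering hX M.
have [e [e1 e2]] := qcounit_iso Sgi M.
have [D [v [w d]]] := tri_ex hT (e ∘ p).
have [e' [e1' e2']] := qcounit_iso Sgi D.
have [f Ef] := fmap_full Sgi (- (e' ∘ v)).
have [k Ek] := fmap_full Sgi (- (w ∘ qcounit Sgi D)).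
have dfk : dist f k (e ∘ p).
  apply/(tri_rot hT)/(tri_rot hT); rewrite Ef Ek !opprK.
  apply: (tri_iso hT _ _ _ _ d (a := idm E) (b := idm _) (d := e')).
  - split; rewrite ?comp1m ?compm1 // fmap1 comp1m -compA e2' compm1 //.
  - by exists (idm _); rewrite comp1m.
  - by exists (idm _); rewrite comp1m.
  - by exists (qcounit Sgi D).
exists; apply: (LeftChoice (lc_d := f) (lc_i := k) pp).
by exists (e ∘ p); rewrite compA e2 comp1m.
Qed.

Variable rc : forall M, right_choice M.
Variable lc : forall M, left_choice M.

Definition sigma (M : T) : T := rc_sigma (rc M).
Definition omega (M : T) : T := lc_omega (lc M).

Definition sigma_rel (M N : T) (mu : hom M N) (s : hom (sigma M) (sigma N)) :=
  exists xi : hom (rc_env (rc M)) (rc_env (rc N)),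
    tri_morph (rc_i (rc M)) (rc_p (rc M)) (rc_d (rc M))
      (rc_i (rc N)) (rc_p (rc N)) (rc_d (rc N)) mu xi s.

Definition omega_rel (M N : T) (mu : hom M N) (s : hom (omega M) (omega N)) :=
  exists xi : hom (lc_cov (lc M)) (lc_cov (lc N)),
    [/\ s ∘ lc_d (lc M) = lc_d (lc N) ∘ fmap Sgi mu,
        xi ∘ lc_i (lc M) = lc_i (lc N) ∘ s
      & mu ∘ lc_p (lc M) = lc_p (lc N) ∘ xi].

Fact sigma_total M N (mu : hom M N) : exists s, sigma_rel mu s.
Proof.
have [XN _] := rc_pre (rc N); have [_ iM] := rc_pre (rc M).
have [xi E] := iM _ (rc_i (rc N) ∘ mu) XN.
have [s m] := tri_fill hT (rc_dist (rc M)) (rc_dist (rc N)) (esym E).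
by exists s, xi.
Qed.

Fact sigma_id M : sigma_rel (idm M) (idm (sigma M)).
Proof. by exists (idm _); split; rewrite ?fmap1 ?comp1m ?compm1. Qed.

Fact sigma_comp M N P (nu : hom N P) (mu : hom M N) t s :
  sigma_rel nu t -> sigma_rel mu s -> sigma_rel (nu ∘ mu) (t ∘ s).
Proof.
move=> [x [a1 a2 a3]] [y [b1 b2 b3]]; exists (x ∘ y); split.
- by rewrite -compA b1 !compA a1.
- by rewrite -compA b2 !compA a2.
- by rewrite fmapM -compA b3 !compA a3.
Qed.

Fact sigma_add M N (mu nu : hom M N) s t :
  sigma_rel mu s -> sigma_rel nu t -> sigma_rel (mu + nu) (s + t).
Proof.
move=> [x [a1 a2 a3]] [y [b1 b2 b3]]; exists (x + y).
by split; rewrite ?fmapD compDl compDr ?a1 ?a2 ?a3 ?b1 ?b2 ?b3.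
Qed.

Fact sigma_opp M N (mu : hom M N) s : sigma_rel mu s -> sigma_rel (- mu) (- s).
Proof.
move=> [x [a1 a2 a3]]; exists (- x).
by split; rewrite ?fmapN compNl compNr ?a1 ?a2 ?a3.
Qed.

Fact sigma_factors M N (mu : hom M N) s :
  sigma_rel mu s -> factors X mu -> factors X s.
Proof.
move=> [xi [_ _ E]] [V [g [h [XV e]]]].
have [_ iM] := rc_pre (rc M); have [XN _] := rc_pre (rc N).
have [g' eg] := iM _ g XV.
have d1 := (tri_rot hT _ _ _).1 (rc_dist (rc M)).
have d2 := (tri_rot hT _ _ _).1 (rc_dist (rc N)).
have i0 : fmap Sg (rc_i (rc M)) ∘ rc_d (rc M) = 0.
  have := tri_comp0 hT ((tri_rot hT _ _ _).1 d1).
  by rewrite compNl => /(congr1 -%R); rewrite opprK oppr0.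
have [|u eu] := tri_weak_kernel hT (t := s) d2.
  by rewrite -E e eg !fmapM -!compA i0 !compm0.
by exists (rc_env (rc N)), u, (rc_p (rc N)).
Qed.

Definition sigma_functor : functor (quotCat hX) (quotCat hX) :=
  lift_functor hX sigma_total sigma_id sigma_comp sigma_add sigma_opp
    sigma_factors.

Lemma sigma_functorE M N (mu : hom M N) s : sigma_rel mu s ->
  @fmap _ _ sigma_functor M N (qpi hX mu) = qpi hX s.
Proof.
exact: (lift_fmapE hX sigma_total sigma_add sigma_opp sigma_factors).
Qed.

Fact omega_total M N (mu : hom M N) : exists s, omega_rel mu s.
Proof.
have [XM _] := lc_pre (lc M); have [_ pN] := lc_pre (lc N).
have [xi E] := pN _ (mu ∘ lc_p (lc M)) XM.
have [hM [dM eM]] := lc_dist (lc M); have [hN [dN eN]] := lc_dist (lc N).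
have [|s [m1 m2 _]] := tri_fill_mid hT dM dN (a := fmap Sgi mu) (d := xi).
  apply: (iso_monic (qcounit_iso Sgi N)).
  by rewrite !compA -qcounit_nat -compA eM eN E.
by exists s, xi; split.
Qed.

Fact omega_id M : omega_rel (idm M) (idm (omega M)).
Proof. by exists (idm _); split; rewrite ?fmap1 ?comp1m ?compm1. Qed.

Fact omega_comp M N P (nu : hom N P) (mu : hom M N) t s :
  omega_rel nu t -> omega_rel mu s -> omega_rel (nu ∘ mu) (t ∘ s).
Proof.
move=> [x [a1 a2 a3]] [y [b1 b2 b3]]; exists (x ∘ y); split.
- by rewrite fmapM -compA b1 !compA a1.
- by rewrite -compA b2 !compA a2.
- by rewrite -compA b3 !compA a3.
Qed.

Fact omega_add M N (mu nu : hom M N) s t :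
  omega_rel mu s -> omega_rel nu t -> omega_rel (mu + nu) (s + t).
Proof.
move=> [x [a1 a2 a3]] [y [b1 b2 b3]]; exists (x + y).
by split; rewrite ?fmapD compDl compDr ?a1 ?a2 ?a3 ?b1 ?b2 ?b3.
Qed.

Fact omega_opp M N (mu : hom M N) s : omega_rel mu s -> omega_rel (- mu) (- s).
Proof.
move=> [x [a1 a2 a3]]; exists (- x).
by split; rewrite ?fmapN compNl compNr ?a1 ?a2 ?a3.
Qed.

Fact omega_factors M N (mu : hom M N) s :
  omega_rel mu s -> factors X mu -> factors X s.
Proof.
move=> [xi [E _ _]] [V [g [h [XV e]]]].
have [XM _] := lc_pre (lc M); have [_ pN] := lc_pre (lc N).
have [h' eh] := pN _ h XV.
have [hM [dM eM]] := lc_dist (lc M); have [hN [dN eN]] := lc_dist (lc N).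
have p0 : lc_d (lc N) ∘ fmap Sgi (lc_p (lc N)) = 0.
  apply: (fmap_faithful Sgi); rewrite fmapM fmap0.
  have -> : fmap Sg (fmap Sgi (lc_p (lc N))) = hN ∘ qcounit Sgi _.
    apply: (iso_monic (qcounit_iso Sgi N)).
    by rewrite -qcounit_nat compA eN.
  have := tri_comp0 hT ((tri_rot hT _ _ _).1 ((tri_rot hT _ _ _).1 dN)).
  rewrite compNl => /(congr1 -%R); rewrite opprK oppr0 compA => ->.
  by rewrite comp0m.
have [|u eu] := tri_weak_cokernel hT (t := s) dM.
  by rewrite E e eh !fmapM !compA p0 !comp0m.
by exists (lc_cov (lc M)), (lc_i (lc M)), u.
Qed.

Definition omega_functor : functor (quotCat hX) (quotCat hX) :=
  lift_functor hX omega_total omega_id omega_comp omega_add omega_opp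
    omega_factors.

Lemma omega_functorE M N (mu : hom M N) s : omega_rel mu s ->
  @fmap _ _ omega_functor M N (qpi hX mu) = qpi hX s.
Proof.
exact: (lift_fmapE hX omega_total omega_add omega_opp omega_factors).
Qed.

Let Q := quotCat hX.

Definition qmap (A B : T) (f : hom A B) : @hom Q A B := qpi hX f.

(* [std_right mu nu pi] : the standard right-triangle
   M --mu--> N --nu--> P --pi--> sigma M  of an X-monomorphism mu. *)
Definition std_right (M N P : T)
    (mu : hom M N) (nu : hom N P) (pi : hom P (sigma M)) :=
  xmono X mu /\
  exists (d : hom P (Sg M)) (n : hom N (rc_env (rc M))),
    dist mu nu d /\
    tri_morph mu nu d (rc_i (rc M)) (rc_p (rc M)) (rc_d (rc M))
      (idm M) n pi.

Definition right_triangle (A B D : Q)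
    (f : hom A B) (g : hom B D) (h : hom D (sigma_functor A)) :=
  exists (M N P : T) (mu : hom M N) (nu : hom N P) (pi : hom P (sigma M))
      (a : @hom Q M A) (b : @hom Q N B) (d : @hom Q P D),
    [/\ std_right mu nu pi, is_iso a, is_iso b, is_iso d
      & @tri_morph Q sigma_functor M N P A B D
          (qmap mu) (qmap nu) (qmap pi) f g h a b d].

(* [std_left pi mu nu] : the standard left-triangle
   omega P --pi--> M --mu--> N --nu--> P  of an X-epimorphism nu. *)
Definition std_left (M N P : T)
    (pi : hom (omega P) M) (mu : hom M N) (nu : hom N P) :=
  xepi X nu /\
  exists (d : hom (Sgi P) M) (n : hom (lc_cov (lc P)) N),
    left_dist d mu nu /\
    [/\ pi ∘ lc_d (lc P) = d, n ∘ lc_i (lc P) = mu ∘ pi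
      & lc_p (lc P) = nu ∘ n].

Definition left_triangle (A B D : Q)
    (h : hom (omega_functor D) A) (f : hom A B) (g : hom B D) :=
  exists (M N P : T) (pi : hom (omega P) M) (mu : hom M N) (nu : hom N P)
      (a : @hom Q M A) (b : @hom Q N B) (d : @hom Q P D),
    [/\ std_left pi mu nu, is_iso a, is_iso b, is_iso d
      & [/\ a ∘ qmap pi = h ∘ @fmap Q Q omega_functor P D d,
             b ∘ qmap mu = f ∘ a & d ∘ qmap nu = g ∘ b]].

Definition quot_pretriangulation : pretriangulation Q :=
  Pretriangulation right_triangle left_triangle.

End Pretriangulation.

(* Main.v *)
From HB Require Import structures.
From mathcomp Require Import all_boot all_order all_algebra.
From mathcomp Require Import boolp.
Require Import Defs.

(** Write d_M : sigma M -> Sg M for the last map of the chosen triangle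
    M -> X_M -> sigma M -> Sg M, and q : T -> T/X for the projection.  The
    standard right-triangles are the (q mu, q nu, q pi) such that
    (mu, nu, d_M pi) is distinguished in T ([std_rightP]), so everything can be
    computed in T after composing with d_M.

    Serre duality gives, for h : B -> D and an object E, that h is killed by all
    maps D -> S E if and only if it kills all maps E -> B
    ([serre_orthogonal]).  In a triangle A -> B -> D -> Sg A the first map is an
    X-monomorphism exactly when its connecting map h : D -> Sg A is killed by
    all maps Sg A -> Sg E with E in X, and the second one is an X-epimorphism
    exactly when h kills all maps E -> D with E in X.

    Suppose tau X = X.  Then the objects Sg E and S E, for E in X, are the same
    up to isomorphism, so in every triangle the first map is an X-monomorphism
    if and only if the second one is an X-epimorphism
    ([mono_epi_of_translation]): with respect to the connecting maps of such
    triangles, T behaves like a Frobenius category whose projective-injective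
    objects are those of X, and T/X like its stable category.  A map f into
    sigma M vanishes in T/X exactly when d_M f = 0 ([cone_q0P]), so sigma is an
    autoequivalence and the axioms for T/X follow from those for T.  The
    converse half of the rotation axiom comes for free once sigma is an
    equivalence ([triangulated_criterion]).

    Conversely, suppose that T/X is triangulated.  Given h : E -> sigma M with E
    in X, the triangle M -> N -> E -> Sg M on d_M h is a standard right-triangle
    whose third object vanishes in T/X, so M -> N is a split monomorphism in T/X
    because sigma is fully faithful, hence also in T, and d_M h = 0
    ([cone_ghost]).  By Serre duality all maps Sg M -> S E kill d_M; for
    M = tau E this gives d_M = 0, so that M is a summand of X_M.  For the
    opposite inclusion take M in X and N with tau N isomorphic to M.  As sigma
    is essentially surjective, N is isomorphic in T/X to some sigma M', while
    Serre duality gives Hom(N, sigma M') = 0 in T/X; hence N vanishes in T/X,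
    that is, N belongs to X. *)

Set Implicit Arguments.
Unset Strict Implicit.
Unset Printing Implicit Defensive.

Import GRing.Theory.
Local Open Scope ring_scope.
Local Open Scope cat_scope.

(** * Isomorphisms and equivalences *)

Section Categories.
Variable C : addCat.

Lemma iso_idm (A : C) : is_iso (idm A).
Proof. by exists (idm A); rewrite comp1m. Qed.

Lemma iso_comp (A B D : C) (g : hom B D) (f : hom A B) :
  is_iso g -> is_iso f -> is_iso (g ∘ f).
Proof.
move=> [g' [g1 g2]] [f' [f1 f2]]; exists (f' ∘ g'); split.
  by rewrite -compA (compA g') g1 comp1m f1.
by rewrite -compA (compA f) f2 comp1m g2.
Qed.

Lemma iso_fmap (D : addCat) (F : functor C D) (A B : C) (f : hom A B) :
  is_iso f -> is_iso (fmap F f).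
Proof.
by move=> [g [e1 e2]]; exists (fmap F g); rewrite -!fmapM e1 e2 !fmap1.
Qed.

Lemma iso_two_sided (A B : C) (f : hom A B) (g h : hom B A) :
  is_iso (g ∘ f) -> is_iso (f ∘ h) -> is_iso f.
Proof.
move=> [x [x1 _]] [y [_ y2]].
have e : x ∘ g = h ∘ y.
  by rewrite -[LHS]compm1 -y2 !compA -(compA x) x1 comp1m.
by exists (h ∘ y); split; [rewrite -e -compA | rewrite compA].
Qed.

Lemma iso_square_zero (A : C) (n : hom A A) :
  n ∘ n = 0 -> is_iso (idm A + n).
Proof.
move=> nn; exists (idm A - n); split.
  by rewrite compBl !compDr !comp1m compm1 nn addr0 addrK.
by rewrite compBr !compDl !compm1 comp1m nn addr0 addrK.
Qed.

(** An equivalence reflects isomorphisms. *)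
Lemma iso_reflect (F : functor C C) (G : quasi_inverse F) (A B : C)
  (f : hom A B) : is_iso (fmap F f) -> is_iso f.
Proof.
move=> [h [e1 e2]]; have [g eg] := fmap_full G h; exists g.
by split; apply: (fmap_faithful G); rewrite fmapM eg fmap1.
Qed.

Lemma zero_iso (Z Z' : C) : zero_object Z -> zero_object Z' ->
  is_iso (0 : hom Z Z').
Proof.
move=> [z1 z2] [z1' z2']; exists 0; split.
  by rewrite (z1 _ (idm Z)) (z1 _ (_ ∘ _)).
by rewrite (z1' _ (idm Z')) (z1' _ (_ ∘ _)).
Qed.

Lemma tri_morph_comp (F : functor C C)
    (A B D A' B' D' A'' B'' D'' : C)
    (f : hom A B) (g : hom B D) (h : hom D (F A))
    (f' : hom A' B') (g' : hom B' D') (h' : hom D' (F A'))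
    (f'' : hom A'' B'') (g'' : hom B'' D'') (h'' : hom D'' (F A''))
    (a : hom A A') (b : hom B B') (d : hom D D')
    (a' : hom A' A'') (b' : hom B' B'') (d' : hom D' D'') :
  tri_morph f g h f' g' h' a b d -> tri_morph f' g' h' f'' g'' h'' a' b' d' ->
  tri_morph f g h f'' g'' h'' (a' ∘ a) (b' ∘ b) (d' ∘ d).
Proof.
move=> [m1 m2 m3] [n1 n2 n3]; split.
- by rewrite -compA m1 !compA n1.
- by rewrite -compA m2 !compA n2.
- by rewrite fmapM -compA m3 !compA n3.
Qed.

(** A fully faithful and essentially surjective endofunctor has a
    quasi-inverse. *)
Lemma ff_autoequivalence (F : functor C C) :
  (forall (A B : C) (h : hom (F A) (F B)), exists f, fmap F f = h) ->
  (forall (A B : C) (f g : hom A B), fmap F f = fmap F g -> f = g) ->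
  (forall A : C, exists (B : C) (e : hom (F B) A), is_iso e) ->
  autoequivalence F.
Proof.
move=> full faith /choice[G0 ess].
pose e A : hom (F (G0 A)) A := projT1 (cid (ess A)).
have e_iso A : is_iso (e A) by rewrite /e; case: cid.
pose e' A : hom A (F (G0 A)) := projT1 (cid (e_iso A)).
have e'e A : e' A ∘ e A = idm _ by rewrite /e'; case: cid => x [].
have ee' A : e A ∘ e' A = idm _ by rewrite /e'; case: cid => x [].
pose L A B (h : hom (F A) (F B)) : hom A B := projT1 (cid (full A B h)).
have LE A B h : fmap F (L A B h) = h by rewrite /L; case: cid.
pose G1 A B (f : hom A B) : hom (G0 A) (G0 B) := L _ _ (e' B ∘ f ∘ e A).
have G_1 A : G1 _ _ (idm A) = idm (G0 A).
  by apply: faith; rewrite LE compm1 e'e fmap1.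
have G_M A B D (g : hom B D) (f : hom A B) :
    G1 _ _ (g ∘ f) = G1 _ _ g ∘ G1 _ _ f.
  apply: faith; rewrite fmapM !LE -!compA (compA (e B)) ee' comp1m.
  by rewrite !compA.
have G_D A B (f g : hom A B) : G1 _ _ (f + g) = G1 _ _ f + G1 _ _ g.
  by apply: faith; rewrite fmapD !LE compDr compDl.
pose G := @Functor C C G0 G1 G_1 G_M G_D.
constructor; apply: (@QuasiInverse C F G e e_iso _
  (fun A => L _ _ (e' (F A)))) => [A B f|A|A B f].
- by rewrite LE !compA ee' comp1m.
- exists (L _ _ (e (F A))).
  by split; apply: faith; rewrite fmapM !LE fmap1 ?e'e ?ee'.
- apply: faith; rewrite !fmapM /= !LE -compA.
  by rewrite ee' compm1.
Qed.

End Categories.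

(** * Retracts of objects of X *)

Section RetractClosed.
Variables (T : addCat) (X : T -> Prop) (hX : functorially_finite X).
Hypothesis hsplit : split_idempotents T.

(** As [X_summand] is about biproducts, a complement of the retract is needed:
    it comes from a splitting of the idempotent 1 - s r. *)
Lemma X_retract (A E : T) (s : hom A E) (r : hom E A) :
  r ∘ s = idm A -> X E -> X A.
Proof.
move=> rs; have [|B [r' [s' [e1 e2]]]] := hsplit (e := idm E - s ∘ r).
  rewrite compBl !compBr !comp1m compm1 -!compA (compA r) rs comp1m.
  by rewrite subrr subr0.
have rs' : r ∘ s' = 0.
  rewrite -[s']compm1 -e1 (compA s') e2 compA compBr compm1 compA rs comp1m.
  by rewrite subrr comp0m.
have sr' : r' ∘ s = 0.
  rewrite -[r']comp1m -e1 -(compA r') e2 -compA compBl comp1m -(compA s).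
  by rewrite rs compm1 subrr compm0.
apply: (X_summand hX (A := A) (B := B) (P := E)
         (i1 := s) (i2 := s') (p1 := r) (p2 := r')).
by split=> //; rewrite e2 addrC subrK.
Qed.

Lemma factors_idm (A : T) : factors X (idm A) -> X A.
Proof. by move=> [E [g [h [XE /esym/X_retract]]]]; apply. Qed.

End RetractClosed.

(** * Triangulated structures with rotation in one direction *)

Section Criterion.
Variables (C : addCat) (F : functor C C) (dist : tri_class F).
(** The axioms of a triangulated category, except that only forward rotation is
    assumed, that the triangle 0 -> A -> A is assumed as well, and that the
    octahedral axiom ([d_oct_rep] below) is required, up to isomorphism, for one
    choice of the three triangles. *)
Hypothesis F_equiv : autoequivalence F.
Hypothesis d_iso : forall (A B D A' B' D' : C)
    (f : hom A B) (g : hom B D) (h : hom D (F A))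
    (f' : hom A' B') (g' : hom B' D') (h' : hom D' (F A'))
    (a : hom A A') (b : hom B B') (d : hom D D'),
  tri_morph f g h f' g' h' a b d -> is_iso a -> is_iso b -> is_iso d ->
  dist f g h -> dist f' g' h'.
Hypothesis d_id : forall A Z : C, zero_object Z ->
  dist (idm A) (0 : hom A Z) 0.
Hypothesis d_id0 : forall A Z : C, zero_object Z ->
  dist (0 : hom Z A) (idm A) 0.
Hypothesis d_ex : forall (A B : C) (f : hom A B),
  exists D g h, @dist A B D f g h.
Hypothesis d_rot : forall (A B D : C) (f : hom A B) (g : hom B D)
    (h : hom D (F A)), dist f g h -> dist g h (- fmap F f).
Hypothesis d_fill : forall (A B D A' B' D' : C)
    (f : hom A B) (g : hom B D) (h : hom D (F A))
    (f' : hom A' B') (g' : hom B' D') (h' : hom D' (F A'))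
    (a : hom A A') (b : hom B B'),
  dist f g h -> dist f' g' h' -> b ∘ f = f' ∘ a ->
  exists d, tri_morph f g h f' g' h' a b d.

Lemma weak_cokernel_of_fill (A B D W : C) (f : hom A B) (g : hom B D) h
    (t : hom B W) : dist f g h -> t ∘ f = 0 -> exists u, t = u ∘ g.
Proof.
move=> dfgh tf; have [Z Z0] := has_zero C.
have [|u [_ E _]] := d_fill dfgh (d_id0 W Z0) (a := 0) (b := t).
  by rewrite tf comp0m.
by exists u; rewrite E comp1m.
Qed.

(** Such an endomorphism is 1 + n with n g = 0 and h n = 0; then n factors
    through h, whence n n = 0. *)
Lemma tri_endo_iso (A B D : C) (f : hom A B) (g : hom B D) h (d : hom D D) :
  dist f g h -> tri_morph f g h f g h (idm A) (idm B) d -> is_iso d.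
Proof.
move=> dfgh [_ dg hd]; rewrite compm1 in dg; rewrite fmap1 comp1m in hd.
have [|x ex] := weak_cokernel_of_fill (d_rot dfgh) (t := d - idm D).
  by rewrite compBl dg comp1m subrr.
suff -> : d = idm D + (d - idm D).
  apply: iso_square_zero; rewrite {1}ex -compA compBr -hd compm1 subrr.
  by rewrite compm0.
by rewrite addrC subrK.
Qed.

Lemma tri_fill_iso (A B D A' B' D' : C)
    (f : hom A B) (g : hom B D) (h : hom D (F A))
    (f' : hom A' B') (g' : hom B' D') (h' : hom D' (F A'))
    (a : hom A A') (b : hom B B') (d : hom D D') :
  dist f g h -> dist f' g' h' -> is_iso a -> is_iso b ->
  tri_morph f g h f' g' h' a b d -> is_iso d.
Proof.
move=> D1 D2 [a' [a1 a2]] [b' [b1 b2]] [m1 m2 m3].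
have [|d' [n1 n2 n3]] := d_fill D2 D1 (a := a') (b := b').
  by rewrite -[b' ∘ f']compm1 -a2 compA -(compA b') -m1 compA b1 comp1m.
apply: (iso_two_sided (g := d') (h := d')).
- apply: (tri_endo_iso D1); split; rewrite ?comp1m ?compm1 //.
    by rewrite -compA m2 compA n2 -compA b1 compm1.
  by rewrite compA -n3 -compA -m3 compA -fmapM a1.
- apply: (tri_endo_iso D2); split; rewrite ?comp1m ?compm1 //.
    by rewrite -compA n2 compA m2 -compA b2 compm1.
  by rewrite compA -m3 -compA -n3 compA -fmapM a2.
Qed.

(** Rotating forward, the suspensions of f, g, h are compared with those of a
    triangle on f, and full faithfulness of F removes the suspensions. *)
Lemma tri_rot_inv (A B D : C) (f : hom A B) (g : hom B D) (h : hom D (F A)) :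
  dist g h (- fmap F f) -> dist f g h.
Proof.
move=> d1; have [G] := F_equiv.
have [D' [g' [h' d2]]] := d_ex f.
have r1 := d_rot (d_rot d1); have r2 := d_rot (d_rot (d_rot d2)).
have [|x m] := d_fill r1 r2 (a := idm _) (b := idm _).
  by rewrite comp1m compm1.
have x_iso := tri_fill_iso r1 r2 (iso_idm _) (iso_idm _) m.
have [d ed] := fmap_full G x.
have d_is : is_iso d by apply: (iso_reflect G); rewrite ed.
case: m; rewrite -ed fmap1 !compm1 comp1m => _ m2 m3.
have e2 : d ∘ g = g'.
  apply: (fmap_faithful G); apply: oppr_inj.
  by rewrite fmapM -compNr m2.
have e3 : h = h' ∘ d.
  apply: (fmap_faithful G); apply: oppr_inj.
  by rewrite fmapM -compNl -m3 comp1m.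
have [d' [e1' e2']] := d_is.
apply: (d_iso _ (iso_idm _) (iso_idm _) _ d2 (d := d')); last by exists d.
split; rewrite ?comp1m ?compm1 //; first by rewrite -e2 compA e1' comp1m.
by rewrite e3 fmap1 comp1m -compA e2' compm1.
Qed.

Hypothesis d_oct_rep : forall (A B D : C) (f : hom A B) (g : hom B D),
  exists (B' D' P Q R : C) (f' : hom A B') (g' : hom B' D')
    (b : hom B' B) (d : hom D' D)
    (f1 : hom B' P) (f2 : hom P (F A)) (g1 : hom D' R) (g2 : hom R (F B'))
    (h1 : hom D' Q) (h2 : hom Q (F A)) (u : hom P Q) (v : hom Q R),
  [/\ [/\ is_iso b, is_iso d, b ∘ f' = f & d ∘ g' = g ∘ b],
      [/\ dist f' f1 f2, dist g' g1 g2 & dist (g' ∘ f') h1 h2]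
    & [/\ dist u v (fmap F f1 ∘ g2),
          u ∘ f1 = h1 ∘ g', h2 ∘ u = f2, v ∘ h1 = g1
        & g2 ∘ v = fmap F f' ∘ h2]].

Theorem triangulated_criterion : triangulated dist.
Proof.
split=> //.
  by move=> *; split; [apply: d_rot | apply: tri_rot_inv].
move=> A B D P Q R f g f1 f2 g1 g2 h1 h2 df dg dh.
have [B' [D' [P' [Q' [R' [f' [g' [b [d [f1' [f2' [g1' [g2' [h1' [h2'
  [u [v [[bi di ef eg] [df' dg' dh'] [duv ou1 ou2 ov1 ov2]]]]]]]]]]]]]]]]]]]
  := d_oct_rep f g.
have [|p mp] := d_fill df' df (a := idm A) (b := b).
  by rewrite ef compm1.
have pi := tri_fill_iso df' df (iso_idm _) bi mp.
have [|q mq] := d_fill dh' dh (a := idm A) (b := d).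
  by rewrite compm1 compA eg -compA ef.
have qi := tri_fill_iso dh' dh (iso_idm _) di mq.
have [r mr] := d_fill dg' dg eg.
have ri := tri_fill_iso dg' dg bi di mr.
case: mp => _ p1; rewrite fmap1 comp1m => p2.
case: mq => _ q1; rewrite fmap1 comp1m => q2.
case: mr => _ r1 r2.
have [p' [pp pp']] := pi; have [q' [qq qq']] := qi.
exists (q ∘ u ∘ p'), (r ∘ v ∘ q'); split.
- apply: (d_iso _ pi qi ri duv); split.
  + by rewrite -compA pp compm1.
  + by rewrite -compA qq compm1.
  + by rewrite compA -fmapM p1 fmapM -!compA r2.
- apply: (iso_epic bi); rewrite -!compA -p1 (compA p') pp comp1m ou1 -eg.
  by rewrite !compA q1.
- by apply: (iso_epic pi); rewrite -!compA pp compm1 compA -q2 ou2 p2.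
- apply: (iso_epic di); rewrite -!compA -q1 (compA q') qq comp1m ov1.
  by rewrite r1.
- apply: (iso_epic qi); rewrite -!compA qq compm1 compA -r2 -compA ov2 compA.
  by rewrite -fmapM ef q2.
Qed.

End Criterion.

(** * Weak kernels and X-monomorphisms in a triangulated category *)

Section TriangleLemmas.
Variables (T : addCat) (Sg : functor T T) (dist : tri_class Sg).
Hypothesis hT : triangulated dist.

Lemma tri_comp0_rot (A B D : T) (f : hom A B) (g : hom B D) h :
  dist f g h -> h ∘ g = 0.
Proof. by move=> /(tri_rot hT)/(tri_comp0 hT). Qed.

Lemma tri_comp0_susp (A B D : T) (f : hom A B) (g : hom B D) h :
  dist f g h -> fmap Sg f ∘ h = 0.
Proof.
move=> /(tri_rot hT)/tri_comp0_rot /eqP.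
by rewrite compNl oppr_eq0 => /eqP.
Qed.

Lemma tri_weak_kernel_rot (A B D W : T) (f : hom A B) (g : hom B D) h
    (t : hom W D) : dist f g h -> h ∘ t = 0 -> exists u, t = g ∘ u.
Proof. by move=> /(tri_rot hT)/(tri_weak_kernel hT); apply. Qed.

Lemma tri_weak_kernel_susp (A B D W : T) (f : hom A B) (g : hom B D) h
    (t : hom W (Sg A)) :
  dist f g h -> fmap Sg f ∘ t = 0 -> exists u, t = h ∘ u.
Proof.
move=> /(tri_rot hT)/tri_weak_kernel_rot d e; apply: d.
by rewrite compNl e oppr0.
Qed.

Lemma tri_weak_cokernel_susp (A B D W : T) (f : hom A B) (g : hom B D) h
    (t : hom (Sg A) (Sg W)) :
  dist f g h -> t ∘ h = 0 -> exists u : hom B W, t = fmap Sg (u ∘ f).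
Proof.
move=> /(tri_rot hT)/(tri_rot hT)/(tri_weak_cokernel hT) d e.
have [u ->] := d _ _ e; have [G] := susp_equiv hT.
have [v ev] := fmap_full G u; exists (- v).
by rewrite fmapM fmapN ev compNl compNr.
Qed.

Lemma tri_fibre_ex (B D : T) (g : hom B D) :
  exists A f h, @dist A B D f g h.
Proof.
have [G] := susp_equiv hT.
have [W [w [v d]]] := tri_ex hT g.
have [c [c1 c2]] := qcounit_iso G W.
have [f ef] := fmap_full G (- (v ∘ qcounit G W)).
exists (G W), f, (c ∘ w); apply/(tri_rot hT); rewrite ef opprK.
apply: (tri_iso hT _ (iso_idm _) (iso_idm _) _ d (d := c)).
  by split; rewrite ?fmap1 ?comp1m ?compm1 // -compA c2 compm1.
by exists (qcounit G W).
Qed.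

Lemma tri_connecting_ex (A D : T) (h : hom D (Sg A)) :
  exists B f g, @dist A B D f g h.
Proof.
have [B [g [v d]]] := tri_fibre_ex h; have [G] := susp_equiv hT.
have [f ef] := fmap_full G (- v).
by exists B, f, g; apply/(tri_rot hT); rewrite ef opprK.
Qed.

Variable X : T -> Prop.

(** X-monomorphisms in terms of the connecting map. *)
Lemma xmonoP (A B D : T) (f : hom A B) (g : hom B D) h : dist f g h ->
  xmono X f <->
  (forall (E : T) (u : hom A E), X E -> fmap Sg u ∘ h = 0).
Proof.
move=> d; split=> [xf E u XE|xf E u XE].
  have [w ->] := xf E u XE.
  by rewrite fmapM -compA (tri_comp0_susp d) compm0.
have [w ew] := tri_weak_cokernel_susp d (xf E u XE); exists w.
by have [G] := susp_equiv hT; apply: (fmap_faithful G).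
Qed.

(** X-epimorphisms in terms of the connecting map. *)
Lemma xepiP (A B D : T) (f : hom A B) (g : hom B D) h : dist f g h ->
  xepi X g <-> (forall (E : T) (v : hom E D), X E -> h ∘ v = 0).
Proof.
move=> d; split=> [xg E v XE|xg E v XE].
  have [w ->] := xg E v XE.
  by rewrite compA (tri_comp0_rot d) comp0m.
exact: (tri_weak_kernel_rot d (xg E v XE)).
Qed.

End TriangleLemmas.

(** * Standard right-triangles *)

Section StdTriangles.
Variables (T : addCat) (Sg : functor T T) (dist : tri_class Sg).
Hypothesis hT : triangulated dist.
Variables (X : T -> Prop) (hX : functorially_finite X).
Variable rc : forall M, right_choice dist X M.

Local Notation Q := (quotCat hX).
Local Notation "'q' f" := (qmap hX f) (at level 10, f at level 9).
Local Notation sig := (sigma rc).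
Local Notation sigF := (sigma_functor hT hX rc).
Local Notation dd M := (rc_d (rc M)).
Local Notation ii M := (rc_i (rc M)).
Local Notation pp M := (rc_p (rc M)).

Lemma qmapM (A B D : T) (g : hom B D) (f : hom A B) :
  q (g ∘ f) = q g ∘ q f.
Proof. by rewrite /qmap /= qcompE. Qed.

Lemma qmap1 (A : T) : q (idm A) = @idm Q A.
Proof. by []. Qed.

Lemma qmapD (A B : T) (f g : hom A B) : q (f + g) = q f + q g.
Proof. exact: qpiD. Qed.

Lemma qmap0 (A B : T) : q (0 : hom A B) = 0.
Proof. exact: qpi0. Qed.

Lemma qmapN (A B : T) (f : hom A B) : q (- f) = - q f.
Proof. by apply/eqP; rewrite -addr_eq0 -qmapD addNr qmap0. Qed.

Lemma qmap_eqP (A B : T) (f g : hom A B) : q f = q g <-> factors X (f - g).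
Proof. exact: qpiP. Qed.

Lemma qmap_eq0 (A B : T) (f : hom A B) : q f = 0 <-> factors X f.
Proof. by rewrite -qmap0 qmap_eqP subr0. Qed.

Lemma qmap_surj (A B : T) (f : @hom Q A B) : exists f0, f = q f0.
Proof. by exists (qrepr f); rewrite /qmap qreprK. Qed.

Lemma qmap_iso (A B : T) (f : hom A B) (g : hom B A) :
  q (g ∘ f) = q (idm A) -> q (f ∘ g) = q (idm B) -> is_iso (q f).
Proof. by move=> e1 e2; exists (q g); rewrite -!qmapM e1 e2. Qed.

Lemma rc_comp0 (M : T) : fmap Sg (ii M) ∘ dd M = 0.
Proof. exact: tri_comp0_susp (rc_dist _). Qed.

(** Composition with d_M maps Hom(A, sigma M) onto the maps A -> Sg M killed by
    Sg i_M, and whatever it kills vanishes in the quotient ([cone_q0]). *)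
Lemma cone_lift (M A : T) (h : hom A (Sg M)) :
  fmap Sg (ii M) ∘ h = 0 -> exists pi, h = dd M ∘ pi.
Proof. exact: (tri_weak_kernel_susp hT (rc_dist (rc M))). Qed.

Lemma cone_q0 (M A : T) (f : hom A (sig M)) : dd M ∘ f = 0 -> q f = 0.
Proof.
move=> /(tri_weak_kernel_rot hT (rc_dist (rc M))) [u ->].
by apply/qmap_eq0; exists (rc_env (rc M)), u, (pp M); split=> //;
  case: (rc_pre (rc M)).
Qed.

Lemma cone_q_eq (M A : T) (f g : hom A (sig M)) :
  dd M ∘ f = dd M ∘ g -> q f = q g.
Proof.
move=> e; apply/eqP; rewrite -subr_eq0 -qmapN -qmapD; apply/eqP/cone_q0.
by rewrite compBr e subrr.
Qed.

(** Since d_M pi determines pi up to a map factoring through X_M, the morphism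
    of triangles in the definition of a standard right-triangle amounts to the
    connecting map being d_M pi; that mu is an X-monomorphism is then
    automatic. *)
Lemma std_rightP (M N P : T) (mu : hom M N) (nu : hom N P)
    (pi : hom P (sig M)) :
  std_right (rc := rc) mu nu pi <-> dist mu nu (dd M ∘ pi).
Proof.
split=> [[_ [d [n [D [_ _]]]]]|D].
  by rewrite fmap1 comp1m => <-.
have [XM iM] := rc_pre (rc M).
have [n0 e0] : exists n0, ii M = n0 ∘ mu.
  have [|w ew] := tri_weak_cokernel_susp hT (t := fmap Sg (ii M)) D.
    by rewrite compA rc_comp0 comp0m.
  by have [G] := susp_equiv hT; exists w; apply: (fmap_faithful G).
split.
  move=> E g XE; have [w ->] := iM E g XE.
  by exists (w ∘ n0); rewrite e0 compA.
have [|pi0 [m1 m2 m3]] := tri_fill hT D (rc_dist (rc M)) (a := idm M) (b := n0).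
  by rewrite compm1.
have [|a ea] := tri_weak_kernel_rot hT (t := pi - pi0) (rc_dist (rc M)).
  by rewrite compBr -m3 fmap1 comp1m subrr.
exists (dd M ∘ pi), (n0 + a ∘ nu); split=> //; split.
- by rewrite compDl -compA (tri_comp0 hT D) compm0 addr0 -e0 compm1.
- by rewrite compDr -m2 compA -ea compBl addrC subrK.
- by rewrite fmap1 comp1m.
Qed.

Lemma xmono_lift (M N P : T) (mu : hom M N) (nu : hom N P) d :
  dist mu nu d -> xmono X mu -> exists pi, d = dd M ∘ pi.
Proof.
move=> D /(xmonoP hT _ D) xm; apply: cone_lift; apply: xm.
by case: (rc_pre (rc M)).
Qed.

(** The value of sigma on q mu, without reference to a map X_M -> X_N. *)
Lemma sigmaE (M N : T) (mu : hom M N) (s : hom (sig M) (sig N)) :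
  fmap Sg mu ∘ dd M = dd N ∘ s -> @fmap _ _ sigF M N (q mu) = q s.
Proof.
move=> e; have [s' Rs] := sigma_total hT rc mu.
rewrite /qmap (sigma_functorE _ _ Rs); apply: cone_q_eq.
by case: Rs => xi [_ _ <-].
Qed.

Lemma sigma_ex (M N : T) (mu : hom M N) :
  exists s : hom (sig M) (sig N), fmap Sg mu ∘ dd M = dd N ∘ s.
Proof. by have [s [xi [_ _ ?]]] := sigma_total hT rc mu; exists s. Qed.

Lemma right_of_dist (M N P : T) (mu : hom M N) (nu : hom N P)
    (pi : hom P (sig M)) : dist mu nu (dd M ∘ pi) ->
  @right_triangle T Sg dist hT X hX rc M N P (q mu) (q nu) (q pi).
Proof.
move=> D; exists M, N, P, mu, nu, pi, (q (idm M)), (q (idm N)), (q (idm P)).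
have i A : is_iso (q (idm A)) by exact: (@iso_idm Q A).
split=> //; first exact/std_rightP.
by split; rewrite ?qmap1 ?(@fmap1 Q) ?(@comp1m Q) ?(@compm1 Q).
Qed.

End StdTriangles.

(** * The quotient category when X-monomorphisms and X-epimorphisms agree *)

Section FrobeniusQuotient.
Variables (T : addCat) (Sg : functor T T) (dist : tri_class Sg).
Hypothesis hT : triangulated dist.
Variable Sgi : quasi_inverse Sg.
Variables (X : T -> Prop) (hX : functorially_finite X).
Variable rc : forall M, right_choice dist X M.
Variable lc : forall M, left_choice dist Sgi X M.
(** The Frobenius condition: the triangles whose first map is an X-monomorphism
    are those whose second map is an X-epimorphism. *)
Hypothesis mono_epi : forall (A B D : T) (f : hom A B) (g : hom B D) h,
  dist f g h -> xmono X f <-> xepi X g.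

Local Notation Q := (quotCat hX).
Local Notation "'q' f" := (qmap hX f) (at level 10, f at level 9).
Local Notation sig := (sigma rc).
Local Notation sigF := (sigma_functor hT hX rc).
Local Notation dd M := (rc_d (rc M)).
Local Notation ii M := (rc_i (rc M)).
Local Notation pp M := (rc_p (rc M)).
Local Notation rt := (@right_triangle T Sg dist hT X hX rc).

(** By the Frobenius condition X_M -> sigma M is an X-epimorphism, so maps from
    objects of X to sigma M are killed by d_M. *)
Lemma cone_kill (M E : T) (f : hom E (sig M)) : X E -> dd M ∘ f = 0.
Proof.
move=> XE; have [_ xi] := rc_pre (rc M).
have /(xepiP hT _ (rc_dist (rc M))) e := (mono_epi (rc_dist (rc M))).1 xi.
exact: e.
Qed.

Lemma cone_q0P (M A : T) (f : hom A (sig M)) : dd M ∘ f = 0 <-> q f = 0.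
Proof.
split; first exact: cone_q0.
move=> /qmap_eq0 [E [g [h [XE ->]]]].
by rewrite compA cone_kill // comp0m.
Qed.

Lemma sigma_full (M N : Q) (h : hom (sigF M) (sigF N)) :
  exists f, fmap sigF f = h.
Proof.
have [s ->] := qmap_surj (A := sig M) (B := sig N) h.
have [|t et] := tri_weak_cokernel hT (t := dd N ∘ s)
  ((tri_rot hT _ _ _).1 (rc_dist (rc M))).
  by rewrite -compA cone_kill //; case: (rc_pre (rc M)).
have [G] := susp_equiv hT; have [mu emu] := fmap_full G t.
by exists (q mu); apply: sigmaE; rewrite emu.
Qed.

Lemma sigma_faithful (M N : Q) (f g : hom M N) :
  fmap sigF f = fmap sigF g -> f = g.
Proof.
move=> /eqP; rewrite -subr_eq0 -fmapB => /eqP e; apply/eqP.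
rewrite -subr_eq0; apply/eqP; move: (f - g) e => {f g} f.
have [mu ->] := qmap_surj f; have [s es] := sigma_ex hT rc mu.
rewrite (sigmaE _ _ es) => /cone_q0P; rewrite -es.
move=> /(tri_weak_cokernel_susp hT (rc_dist (rc M))) [u].
have [G] := susp_equiv hT => /(fmap_faithful G) ->.
apply/qmap_eq0; exists (rc_env (rc M)), (ii M), u; split=> //.
by case: (rc_pre (rc M)).
Qed.

(** N is isomorphic to sigma M for M the fibre of a precover of N: both N and
    sigma M represent, modulo X, the maps to Sg M that vanish on X. *)
Lemma sigma_ess_surj (N : Q) :
  exists (M : Q) (e : hom (sigF M) N), is_iso e.
Proof.
have [E [p [XE xp]]] := X_precovering hX N.
have [M [j [del D]]] := tri_fibre_ex hT p.
have xj := (mono_epi D).2 xp.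
have [pi epi] := xmono_lift hT rc D xj.
have [|pi' epi'] := tri_weak_kernel_susp hT (t := dd M) D.
  have [_ xi] := rc_pre (rc M).
  exact: ((xmonoP hT _ (rc_dist (rc M))).1 xi).
exists M, (q pi'); apply: (qmap_iso (g := pi)).
  by apply: (cone_q_eq hT); rewrite compA -epi -epi' compm1.
have [|a ea] := tri_weak_kernel_rot hT (t := pi' ∘ pi - @idm T N) D.
  by rewrite compBr compA -epi' -epi compm1 subrr.
by apply/qmap_eqP; rewrite ea; exists E, a, p.
Qed.

Lemma sigma_autoequivalence : autoequivalence sigF.
Proof.
exact: (ff_autoequivalence sigma_full sigma_faithful sigma_ess_surj).
Qed.

Lemma rightP (A B D : Q) (f : hom A B) (g : hom B D) (h : hom D (sigF A)) :
  rt f g h <-> exists (M N P : T) (mu : hom M N) (nu : hom N P)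
      (pi : hom P (sig M)) (a : @hom Q M A) (b : @hom Q N B) (d : @hom Q P D),
    [/\ dist mu nu (dd M ∘ pi), is_iso a, is_iso b, is_iso d
      & @tri_morph Q sigF M N P A B D (q mu) (q nu) (q pi) f g h a b d].
Proof.
by split=> -[M [N [P [mu [nu [pi [a [b [d [/(std_rightP hT) ? ? ? ? ?]]]]]]]]]];
  exists M, N, P, mu, nu, pi, a, b, d; split=> //; apply/(std_rightP hT).
Qed.

Lemma right_iso (A B D A' B' D' : Q)
    (f : hom A B) (g : hom B D) (h : hom D (sigF A))
    (f' : hom A' B') (g' : hom B' D') (h' : hom D' (sigF A'))
    (a : hom A A') (b : hom B B') (d : hom D D') :
  tri_morph f g h f' g' h' a b d -> is_iso a -> is_iso b -> is_iso d ->
  rt f g h -> rt f' g' h'.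
Proof.
move=> m ai bi di [M [N [P [mu [nu [pi [a0 [b0 [d0 [s i1 i2 i3 m0]]]]]]]]]].
exists M, N, P, mu, nu, pi, (a ∘ a0), (b ∘ b0), (d ∘ d0).
by split=> //; try apply: iso_comp => //; apply: tri_morph_comp m0 m.
Qed.

Lemma zero_object_quot (Z : T) : zero_object Z -> @zero_object Q Z.
Proof.
move=> [z1 z2]; split=> A f; have [f0 ->] := qmap_surj f.
  by rewrite (z1 _ f0) qmap0.
by rewrite (z2 _ f0) qmap0.
Qed.

Lemma right_id (A Z : Q) : zero_object Z ->
  rt (idm A) (0 : hom A Z) 0.
Proof.
move=> Z0; have [Z' Z0'] := has_zero T.
have := tri_id hT A Z0'; rewrite -(compm0 _ (dd A)) => /(right_of_dist hT hX).
apply: (right_iso (a := idm _) (b := idm _) (d := 0)).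
- by split; rewrite ?qmap0 ?qmap1 ?comp1m ?compm1 ?compm0 ?comp0m.
- exact: iso_idm.
- exact: iso_idm.
- exact: zero_iso (zero_object_quot Z0') Z0.
Qed.

Lemma right_id0 (A Z : Q) : zero_object Z ->
  rt (0 : hom Z A) (idm A) 0.
Proof.
move=> Z0; have [Z' Z0'] := has_zero T.
have : dist (0 : hom Z' A) (@idm T A) (dd Z' ∘ 0).
  rewrite compm0; apply/(tri_rot hT); rewrite fmap0 oppr0; apply: tri_id => //.
  have e : idm (Sg Z') = 0 by rewrite -fmap1 (Z0'.1 _ (idm Z')) fmap0.
  split=> B f; first by rewrite -[f]comp1m e comp0m.
  by rewrite -[f]compm1 e compm0.
move=> /(right_of_dist hT hX).
apply: (right_iso (a := 0) (b := idm _) (d := idm _)).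
- by split; rewrite ?qmap0 ?qmap1 ?comp1m ?compm1 ?compm0 ?comp0m.
- exact: zero_iso (zero_object_quot Z0') Z0.
- exact: iso_idm.
- exact: iso_idm.
Qed.

(** Every map f : A -> B becomes an X-monomorphism after adding an object of X
    to its target: take (f, i_A) with values in the sum of B and X_A. *)
Lemma xmono_replacement (A B : T) (f : hom A B) :
  exists (B' : T) (b : hom B' B) (f' : hom A B'),
    [/\ xmono X f', b ∘ f' = f & is_iso (q b)].
Proof.
have [XA iA] := rc_pre (rc A).
have [P [i1 [i2 [p1 [p2 [e1 e2 e21 e12 e]]]]]] :=
  has_biproducts B (rc_env (rc A)).
exists P, p1, (i1 ∘ f + i2 ∘ ii A); split.
- move=> E g XE; have [w ->] := iA E g XE; exists (w ∘ p2).
  by rewrite compDr !compA -!(compA w) e21 e2 comp0m compm0 comp1m add0r.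
- by rewrite compDr !compA e1 e12 comp1m comp0m addr0.
- apply: (qmap_iso (g := i1)); last by rewrite e1.
  apply/esym/qmap_eqP; rewrite -e addrAC subrr add0r.
  by exists (rc_env (rc A)), p2, i2.
Qed.

Lemma right_ex (A B : Q) (f : hom A B) : exists D g h, @rt A B D f g h.
Proof.
have [f0 ->] := qmap_surj f.
have [B' [b [f' [xf <- bi]]]] := xmono_replacement f0.
have [D [g [h d]]] := tri_ex hT f'.
have [pi epi] := xmono_lift hT rc d xf; rewrite epi in d.
have [b' [b1 b2]] := bi.
exists D, (q g ∘ b'), (q pi).
apply: (right_iso _ (iso_idm _) bi (iso_idm _) (right_of_dist hT hX d)).
split; first by rewrite compm1 qmapM.
  by rewrite -compA b1 comp1m compm1.
by rewrite fmap1 comp1m compm1.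
Qed.

Lemma std_fill (M N P M' N' P' : T)
    (mu : hom M N) (nu : hom N P) (pi : hom P (sig M))
    (mu' : hom M' N') (nu' : hom N' P') (pi' : hom P' (sig M'))
    (a : @hom Q M M') (b : @hom Q N N') :
  dist mu nu (dd M ∘ pi) -> dist mu' nu' (dd M' ∘ pi') ->
  b ∘ q mu = q mu' ∘ a ->
  exists d : @hom Q P P',
    @tri_morph Q sigF _ _ _ _ _ _ (q mu) (q nu) (q pi)
      (q mu') (q nu') (q pi') a b d.
Proof.
move=> d1 d2; have [a0 ->] := qmap_surj a; have [b0 ->] := qmap_surj b.
move=> e; have := e; rewrite -!qmapM => /qmap_eqP [V [u [v [XV ev]]]].
have [xmu _] := (std_rightP hT _ _ _).2 d1.
(* b mu - mu' a factors through X, hence through mu; correcting b by a map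
   factoring through X makes the square commute in T. *)
have [w ew] := xmu _ u XV.
have eb : q (b0 - v ∘ w) = q b0.
  by apply/qmap_eqP; rewrite addrAC subrr add0r -compNl; exists V, w, (- v).
have e' : (b0 - v ∘ w) ∘ mu = mu' ∘ a0.
  by rewrite compBl -compA -ew -ev opprB addrC subrK.
have [d [_ m2 m3]] := tri_fill hT d1 d2 e'.
exists (q d); split=> //; first by rewrite -eb -!qmapM m2.
have [s es] := sigma_ex hT rc a0.
rewrite (sigmaE _ _ es) -!qmapM; apply: (cone_q_eq hT).
by rewrite compA -es -compA m3 compA.
Qed.

Lemma right_fill (A B D A' B' D' : Q)
    (f : hom A B) (g : hom B D) (h : hom D (sigF A))
    (f' : hom A' B') (g' : hom B' D') (h' : hom D' (sigF A'))
    (a : hom A A') (b : hom B B') :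
  rt f g h -> rt f' g' h' -> b ∘ f = f' ∘ a ->
  exists d, tri_morph f g h f' g' h' a b d.
Proof.
move=> /rightP [M1 [N1 [P1 [mu1 [nu1 [pi1 [a1 [b1 [d1 [D1]]]]]]]]]].
move=> [a1' [a1l a1r]] [b1' [b1l b1r]] [d1' [d1l d1r]] [m1 m2 m3].
move=> /rightP [M2 [N2 [P2 [mu2 [nu2 [pi2 [a2 [b2 [d2 [D2]]]]]]]]]].
move=> [a2' [a2l a2r]] [b2' [b2l b2r]] [d2' [d2l d2r]] [n1 n2 n3] e.
have [|d [_ k2 k3]] :=
  std_fill (a := a2' ∘ a ∘ a1) (b := b2' ∘ b ∘ b1) D1 D2.
  rewrite -!compA m1 (compA b) e -compA.
  have -> : f' = b2 ∘ q mu2 ∘ a2' by rewrite n1 -compA a2r compm1.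
  by rewrite !compA b2l comp1m.
exists (d2 ∘ d ∘ d1'); split=> //.
  have -> : g = d1 ∘ q nu1 ∘ b1' by rewrite m2 -compA b1r compm1.
  rewrite !compA -(compA _ d1') d1l compm1 -(compA d2) k2 compA n2.
  by rewrite -!compA b1r compm1 (compA b2) b2r comp1m.
have -> : h = fmap sigF a1 ∘ q pi1 ∘ d1' by rewrite m3 -compA d1r compm1.
have -> : fmap sigF a = fmap sigF a2 ∘ fmap sigF (a2' ∘ a ∘ a1) ∘
    fmap sigF a1'.
  rewrite -!fmapM; congr fmap.
  by rewrite -!compA a1r compm1 compA a2r comp1m.
rewrite !compA -(compA _ _ (fmap sigF a1)) -(fmapM _ a1') a1l fmap1 compm1.
by rewrite -(compA _ _ (q pi1)) k3 !compA n3.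
Qed.

(** With w : A -> M the fibre of M -> X_M, the octahedron on A -> M -> N compares
    the cone Z of mu w, which carries a standard right-triangle
    N -> Z -> sigma M on - Sg mu d_M, with the cone P of mu: the triangle
    X_M -> Z -> P has zero connecting map, so Z -> P is invertible in T/X. *)
Lemma std_rot (M N P : T)
    (mu : hom M N) (nu : hom N P) (pi : hom P (sig M)) :
  dist mu nu (dd M ∘ pi) ->
  @rt N P (sig M) (q nu) (q pi) (- @fmap _ _ sigF M N (q mu)).
Proof.
move=> D; have [G] := susp_equiv hT.
have [c' [c1 c2]] := qcounit_iso G (sig M); set c := qcounit _ _ in c1 c2.
(* With this sign, rotating (w, i_M, c' p_M) gives (i_M, c' p_M, d_M c), which is
   isomorphic to the chosen triangle of M. *)
have [w ew] := fmap_full G (- (dd M ∘ c)).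
have Dw : dist w (ii M) (c' ∘ pp M).
  apply/(tri_rot hT); rewrite ew opprK.
  apply: (tri_iso hT _ (iso_idm _) (iso_idm _) _ (rc_dist (rc M)) (d := c')).
    by split; rewrite ?fmap1 ?comp1m ?compm1 // -compA c2 compm1.
  by exists c.
have [Z [h1 [h2 Dh]]] := tri_ex hT (mu ∘ w).
have [u [v [Duv _ _ vh vd]]] := tri_oct hT Dw D Dh.
rewrite compA rc_comp0 // comp0m in Duv.
have [s es] := sigma_ex hT rc mu.
have DZ : dist h1 (- (c ∘ h2)) (dd N ∘ (- s)).
  have := (tri_rot hT _ _ _).1 Dh; rewrite fmapM ew compNr opprK.
  apply: (tri_iso hT _ (iso_idm _) (iso_idm _) _ (d := - c)).
    split; rewrite ?fmap1 ?comp1m ?compm1 ?compNl //.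
    by rewrite !(compNl, compNr) opprK compA es.
  by exists (- c'); rewrite !(compNl, compNr) !opprK.
apply: (right_iso _ (iso_idm _) _ (iso_idm _) (right_of_dist hT hX DZ)
  (b := q v)).
  split; first by rewrite compm1 -qmapM vh.
    rewrite comp1m -qmapM; apply: (cone_q_eq hT).
    by rewrite compA vd ew compNr compNl compA.
  by rewrite fmap1 comp1m compm1 qmapN (sigmaE _ _ es).
have [|z ez] := tri_weak_kernel_rot hT (t := idm P) Duv.
  by rewrite comp0m.
apply: (qmap_iso (g := z)); last by rewrite ez.
have [|y ey] := tri_weak_kernel hT (t := z ∘ v - idm Z) Duv.
  by rewrite compBr compA -ez comp1m compm1 subrr.
apply/qmap_eqP; rewrite ey; exists (rc_env (rc M)), y, u; split=> //.
by case: (rc_pre (rc M)).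
Qed.

Lemma right_rot (A B D : Q) (f : hom A B) (g : hom B D)
    (h : hom D (sigF A)) : rt f g h -> rt g h (- fmap sigF f).
Proof.
move=> /rightP [M [N [P [mu [nu [pi [a [b [d [D0 ai bi di [m1 m2 m3]]]]]]]]]]].
apply: (right_iso _ bi di (iso_fmap sigF ai) (std_rot D0)).
by split=> //; rewrite compNr compNl -!fmapM m1.
Qed.

(** After replacing f and g by X-monomorphisms in T, their composite is again an
    X-monomorphism and the octahedron of T projects to T/X. *)
Lemma right_oct (A B D : Q) (f : hom A B) (g : hom B D) :
  exists (B' D' P Q' R : Q) (f' : hom A B') (g' : hom B' D')
    (b : hom B' B) (d : hom D' D)
    (f1 : hom B' P) (f2 : hom P (sigF A)) (g1 : hom D' R) (g2 : hom R (sigF B'))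
    (h1 : hom D' Q') (h2 : hom Q' (sigF A)) (u : hom P Q') (v : hom Q' R),
  [/\ [/\ is_iso b, is_iso d, b ∘ f' = f & d ∘ g' = g ∘ b],
      [/\ rt f' f1 f2, rt g' g1 g2 & rt (g' ∘ f') h1 h2]
    & [/\ rt u v (fmap sigF f1 ∘ g2),
          u ∘ f1 = h1 ∘ g', h2 ∘ u = f2, v ∘ h1 = g1
        & g2 ∘ v = fmap sigF f' ∘ h2]].
Proof.
have [f0 ->] := qmap_surj f; have [g0 ->] := qmap_surj g.
have [B' [b [f' [xf <- bi]]]] := xmono_replacement f0.
have [D' [d [g' [xg eg di]]]] := xmono_replacement (g0 ∘ b).
have xgf : xmono X (g' ∘ f').
  move=> E e XE; have [e1 ->] := xf _ e XE; have [e2 ->] := xg _ e1 XE.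
  by exists e2; rewrite compA.
have [P [f1 [f2 Df]]] := tri_ex hT f'.
have [R [g1 [g2 Dg]]] := tri_ex hT g'.
have [Q' [h1 [h2 Dh]]] := tri_ex hT (g' ∘ f').
have [pf epf] := xmono_lift hT rc Df xf.
have [pg epg] := xmono_lift hT rc Dg xg.
have [ph eph] := xmono_lift hT rc Dh xgf.
have [u [v [Duv uf hu vh gv]]] := tri_oct hT Df Dg Dh; subst f2 g2 h2.
have [s es] := sigma_ex hT rc f'; have [t et] := sigma_ex hT rc f1.
rewrite compA et -compA in Duv.
exists B', D', P, Q', R, (q f'), (q g'), (q b), (q d), (q f1), (q pf),
  (q g1), (q pg), (q h1), (q ph), (q u), (q v).
split; split=> //; rewrite ?(sigmaE _ _ et) ?(sigmaE _ _ es) -?qmapM ?eg //;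
  try exact: right_of_dist.
- by rewrite uf.
- by apply: (cone_q_eq hT); rewrite compA hu.
- by rewrite vh.
- by apply: (cone_q_eq hT); rewrite !compA gv compA es.
Qed.

Theorem quot_triangulated :
  is_triangulated_structure (quot_pretriangulation hT hX rc lc).
Proof.
apply: triangulated_criterion.
- exact: sigma_autoequivalence.
- exact: right_iso.
- exact: right_id.
- exact: right_id0.
- exact: right_ex.
- exact: right_rot.
- exact: right_fill.
- exact: right_oct.
Qed.

End FrobeniusQuotient.

(** * Serre duality *)

Section SerreDuality.
Variables (k : fieldType) (T : linCat k) (S : serre_functor T).

Lemma serre_nondegl (A B : T) (f : lhom A B) :
  (forall g, serre_dual S A B f g = 0) -> f = 0.
Proof.
move=> f0; apply: (bij_inj (serre_dual_bij S A B)); rewrite linear0.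
by apply/lfunP=> g; rewrite f0 lfunE.
Qed.

(** By finite dimensionality, g is determined by its coordinates, and each
    coordinate functional is represented by some f. *)
Lemma serre_nondegr (A B : T) (g : lhom B (S A)) :
  (forall f, serre_dual S A B f g = 0) -> g = 0.
Proof.
move=> g0; rewrite (coord_vbasis (memvf g)); apply: big1 => i _.
have [D _ DK] := serre_dual_bij S A B.
have := g0 (D (linfun (coord (vbasis fullv) i : _ -> k^o))).
by rewrite DK lfunE /= => ->; rewrite scale0r.
Qed.

(** Both sides say that the pairing of v with g h vanishes for all v and g. *)
Lemma serre_orthogonal (E B D : T) (h : hom B D) :
  (forall g : hom D (S E), g ∘ h = 0) <-> (forall v : hom E B, h ∘ v = 0).
Proof.
split=> [gh v|hv g].
  apply: serre_nondegl => g; rewrite serre_dual_natr.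
  by rewrite (gh g) linear0.
apply: serre_nondegr => v.
by rewrite -serre_dual_natr (hv v) linear0 lfunE.
Qed.

End SerreDuality.

(** * The translation and the quotient category *)

Section TranslationAndQuotient.
Variables (k : fieldType) (T : linCat k).
Variables (Sg : functor T T) (dist : tri_class Sg).
Hypothesis hT : triangulated dist.
Variables (Sgi : quasi_inverse Sg) (S : serre_functor T).
Variables (X : T -> Prop) (hX : functorially_finite X).

Lemma mono_epi_of_translation : image_eq (AR_translation Sgi S) X ->
  forall (A B D : T) (f : hom A B) (g : hom B D) h,
    dist f g h -> xmono X f <-> xepi X g.
Proof.
move=> tX A B D f g h d; rewrite (xmonoP hT _ d) (xepiP hT _ d).
split=> [xf E v XE|xg E u XE].
  have XtE : X (Sgi (S E)).
    by apply/tX; exists E => //; exists (idm _); exact: iso_idm.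
  have [c [c1 c2]] := qcounit_iso Sgi (S E).
  apply/serre_orthogonal: v => w.
  have [u eu] := fmap_full Sgi (c ∘ w).
  by rewrite -[w]comp1m -c2 -!compA (compA c) -eu xf // compm0.
have [N XN [e ei]] := (tX E).2 XE.
have [c [c1 c2]] := qcounit_iso Sgi (S N).
apply: (iso_monic (iso_fmap Sg ei)); apply: (iso_monic (qcounit_iso Sgi (S N))).
rewrite !compm0 !compA.
have /(serre_orthogonal S) := fun v : hom N D => xg N v XN.
exact.
Qed.

Variable rc : forall M : T, right_choice dist X M.
Hypothesis hsplit : split_idempotents T.
Hypothesis hQ : triangulated (@right_triangle T Sg dist hT X hX rc).

Local Notation Q := (quotCat hX).
Local Notation "'q' f" := (qmap hX f) (at level 10, f at level 9).
Local Notation sig := (sigma rc).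
Local Notation sigF := (sigma_functor hT hX rc).
Local Notation dd M := (rc_d (rc M)).

(** The map X_M -> sigma M is an X-epimorphism when the quotient is
    triangulated. *)
Lemma cone_ghost (M E : T) (h : hom E (sig M)) : X E -> dd M ∘ h = 0.
Proof.
move=> XE; have [N [mu [nu D]]] := tri_connecting_ex hT (dd M ∘ h).
have [G] := susp_equiv hQ.
have r := right_of_dist hT hX D.
(* E vanishes in T/X, so the identity of sigma M factors through sigma mu. *)
have [|u eu] := tri_weak_cokernel hQ (t := @idm Q (sig M))
   ((tri_rot hQ _ _ _).1 ((tri_rot hQ _ _ _).1 r)).
  by rewrite comp1m; apply/qmap_eq0; exists E, (idm E), h; rewrite compm1.
have [v0 ev] := fmap_full G u; have [v ev0] := qmap_surj v0.
have e1 : q (idm M) = q (- (v ∘ mu)).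
  apply: (fmap_faithful G); rewrite qmapN qmapM -ev0 fmapN fmapM ev.
  by rewrite -compNr qmap1 fmap1.
move/qmap_eqP: e1 => [V [a [b [XV eab]]]].
have [xmu _] := (std_rightP hT (rc := rc) _ _ _).2 D.
(* id_M + v mu factors through X, hence through the X-monomorphism mu. *)
have [w ew] := xmu _ a XV.
have e : idm M = (b ∘ w - v) ∘ mu.
  by rewrite compBl -compA -ew -eab opprK addrK.
rewrite -[dd M ∘ h]comp1m -fmap1 e fmapM -compA.
by rewrite (tri_comp0_susp hT D) compm0.
Qed.

(** If d_M = 0 then M -> X_M is a split monomorphism. *)
Lemma cone_eq0 (M : T) : dd M = 0 -> X M.
Proof.
move=> d0; have [XM _] := rc_pre (rc M).
have [|r er] := tri_weak_cokernel_susp hT (t := idm _) (rc_dist (rc M)).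
  by rewrite d0 compm0.
apply: (X_retract hX hsplit (s := rc_i (rc M)) (r := r)) XM.
by apply: (fmap_faithful Sgi); rewrite -er fmap1.
Qed.

Lemma translation_of_triangulated : image_eq (AR_translation Sgi S) X.
Proof.
move=> M; split=> [[E XE [e [e' [e1 e2]]]]|XM].
  apply: (X_iso hX (A := Sgi (S E))).
    by exists e', e.
  apply: cone_eq0; apply: (iso_monic (qcounit_iso Sgi (S E))).
  rewrite compm0; move: (qcounit Sgi (S E)).
  by apply/serre_orthogonal => v; apply: cone_ghost.
have [GS] := serre_equiv S; pose N : T := GS (Sg M).
have Xe : isomorphic M (Sgi (S N)).
  have [c' c'P] := qcounit_iso GS (Sg M).
  exists (fmap Sgi c' ∘ qunit Sgi M); apply: iso_comp (qunit_iso Sgi M).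
  by apply: iso_fmap; exists (qcounit GS (Sg M)); case: c'P.
exists N => //; have [G] := susp_equiv hQ.
pose M' : T := qinv G N.
(* A map Sg M' -> S N is, as S N and Sg M are isomorphic, the suspension of a
   map from M' to the object M of X, so it kills d_M'. *)
have zero (h : hom N (sig M')) : q h = 0.
  apply: (cone_q0 hT); move: h; apply/(serre_orthogonal S) => g.
  apply: (iso_monic (qcounit_iso GS (Sg M))).
  have [u eu] := fmap_full Sgi (qcounit GS (Sg M) ∘ g).
  rewrite compA -eu compm0.
  have [_ xi] := rc_pre (rc M').
  exact: (xmonoP hT _ (rc_dist (rc M'))).1 xi M u XM.
have [psi [_ e]] := qcounit_iso G (N : Q).
have [h eh] := qmap_surj psi.
apply: (factors_idm hX hsplit); apply/(qmap_eq0 hX).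
by rewrite qmap1 -e eh (zero h) compm0.
Qed.

End TranslationAndQuotient.

Theorem theorem2p3 (k : closedFieldType) (T : linCat k)
    (Sg : functor T T) (dist : tri_class Sg) (hT : triangulated dist)
    (Sg_linear : linear_functor Sg) (Sgi : quasi_inverse Sg)
    (S : serre_functor T) (hsplit : split_idempotents T)
    (X : T -> Prop) (hX : functorially_finite X)
    (rc : forall M : T, right_choice dist X M)
    (lc : forall M : T, left_choice dist Sgi X M) :
  is_triangulated_structure (quot_pretriangulation hT hX rc lc)
    <-> image_eq (AR_translation Sgi S) X.
Proof.
split=> [hQ|tX]; first exact: translation_of_triangulated hsplit hQ.
exact: quot_triangulated (mono_epi_of_translation hT tX).
Qed.
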